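(* Every fixed-II-plane is of exactly one of the following two types. 1. (fixed-II$_1$-plane) It contains exactly $\mathrm g$ fixed points, $q-\mathrm n$ I$_{\vdots}$-points, $(\mathrm g-1)(q-\mathrm n)$ II$_{\vdots}$-points and $q^2+q+1-\mathrm g(q-\mathrm n+1)$ II$_{.:}$-points; and it contains $1$ fixed-I-line and $\mathrm g-1$ fixed-II-lines. The total number of fixed-II$_1$-planes is $\mathrm g(q-2+\mathrm g-\mathrm n)(q+1)(q^2+q+1)$. 2. (fixed-II$_2$-plane) It contains exactly $\mathrm g$ fixed points, $\mathrm g(q-\mathrm n)$ II$_{\vdots}$-points and $q^2+q+1-\mathrm g(q-\mathrm n+1)$ II$_{.:}$-points; and it contains $\mathrm g$ fixed-II-lines. The total number of fixed-II$_2$-planes is $(q^3-q)(q^2+q+1)$.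
   Context: Let $q>2$ be a prime power, $\mathrm n\in\{-1,0,1\}$ with $q\equiv\mathrm n\pmod 3$, $\mathrm g=\gcd(3,q-1)$. Let $\phi$ be a collineation of $\mathrm{PG}(2,q^3)$ of order 3 fixing pointwise an $\mathbb F_q$-subplane $\mathcal P_{2,q}$. A point $\bar P$ of $\mathrm{PG}(2,q^3)$ has Type I if in $\mathcal P_{2,q}$, Type II if $\bar P,\bar P^\phi,\bar P^{\phi^2}$ are distinct and collinear, Type III if non-collinear. Bose representation: identifying $\mathbb F_{q^3}^3$ with $\mathbb F_q^9$, each point $\bar P$ corresponds to a plane $[\![P]\!]$ of $\mathrm{PG}(8,q)$; a point is an X-point if it lies in $[\![P]\!]$ with $\bar P$ of Type X. $\phi$ induces a projectivity $\sigma$ of $\mathrm{PG}(8,q)$ of order 3 with $[\![P]\!]^\sigma=[\![P^\phi]\!]$. A fixed point is a point fixed by $\sigma$. A I-point $A$ is a I$_{\vdots}$-point if $A,A^\sigma,A^{\sigma^2}$ are distinct and collinear; a II-point $B$ is a II$_{\vdots}$-point if $B,B^\sigma,B^{\sigma^2}$ are collinear and a II$_{.:}$-point if they form a triangle. A fixed-I-line (fixed-II-line) is a $\sigma$-fixed line containing a I$_{\vdots}$-point (II$_{\vdots}$-point). A fixed-II-plane is a $\sigma$-fixed plane containing at least one II$_{.:}$-point. *)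

(* Defs.v *)
From HB Require Import structures.
From mathcomp Require Import all_boot all_order all_algebra all_fingroup all_field.

Set Implicit Arguments.
Unset Strict Implicit.
Unset Printing Implicit Defensive.

Import GRing.Theory.
Local Open Scope ring_scope.

(* The subspaces of PG(2, q^3) are the {vspace 'rV[L]_3}, over the field L;   *)
(* those of PG(8, q) are the {vspace bose_space L}, over F, where L^3 is      *)
(* regarded as a vector space over F, of dimension 9 (lemma dim_bose_space).  *)
(* Points, lines and planes are the subspaces of vector space dimension 1, 2  *)
(* and 3, and incidence is inclusion of subspaces.                            *)

Notation bose_space L := {ffun 'I_3 -> L}.

Definition bose_vec (F : fieldType) (L : fieldExtType F) (v : 'rV[L]_3) :
  bose_space L := [ffun i => v 0 i].

(* The subspace of PG(8, q) that corresponds to a subspace P of PG(2, q^3):   *)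
(* the products b v, with b in an F-basis of L and v in an L-basis of P, span *)
(* P over F (lemma mem_bose).                                                 *)
Definition bose (F : fieldType) (L : fieldExtType F) (P : {vspace 'rV[L]_3}) :
    {vspace bose_space L} :=
  <<[seq bose_vec (b *: v) | b <- vbasis {:L}, v <- vbasis P]>>%VS.

Lemma dim_bose_space (F : fieldType) (L : fieldExtType F) :
  \dim {:L} = 3%N -> \dim {: bose_space L} = 9%N.
Proof. by move=> d3; rewrite !dimvf /dim /= card_ord -dimvf d3. Qed.

Lemma bose_vecK (F : fieldType) (L : fieldExtType F) :
  cancel (@bose_vec F L) (fun w => \row_i w i).
Proof. by move=> v; apply/rowP=> i; rewrite mxE ffunE. Qed.

Lemma bose_vec_sum (F : fieldType) (L : fieldExtType F) I (r : seq I)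
    (G : I -> 'rV[L]_3) :
  bose_vec (\sum_(i <- r) G i) = \sum_(i <- r) bose_vec (G i).
Proof.
elim/big_rec2: _ => [|i y1 y2 _ <-]; first by apply/ffunP=> i; rewrite !ffunE mxE.
by apply/ffunP=> j; rewrite !ffunE mxE.
Qed.

Lemma bose_vecZ (F : fieldType) (L : fieldExtType F) (c : F) (v : 'rV[L]_3) :
  bose_vec (c%:A *: v) = c *: bose_vec v.
Proof. by apply/ffunP=> i; rewrite !ffunE mxE mulr_algl. Qed.

Lemma mem_bose (F : fieldType) (L : fieldExtType F) (P : {vspace 'rV[L]_3})
  (v : 'rV[L]_3) : (bose_vec v \in bose P) = (v \in P).
Proof.
apply/idP/idP=> [vP|/coord_vbasis vE].
  pose X := in_tuple [seq bose_vec (b *: u) | b <- vbasis {:L}, u <- vbasis P].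
  have vE : bose_vec v = \sum_i coord X i (bose_vec v) *: X`_i.
    exact: coord_span.
  rewrite -(bose_vecK v) vE.
  have XP i : exists2 u, u \in P & X`_i = bose_vec u.
    case: (ltnP i (size X)) => [lti|gei]; last first.
      exists 0; first exact: mem0v.
      by rewrite nth_default //; apply/ffunP=> j; rewrite !ffunE mxE.
    have /allpairsP[[b u] /= [_ uP ->]] := mem_nth 0 lti.
    by exists (b *: u) => //; apply/memvZ/vbasis_mem.
  suff [u uP ->] : exists2 u, u \in P &
      \sum_i coord X i (bose_vec v) *: X`_i = bose_vec u by rewrite bose_vecK.
  elim/big_ind: _ => [|_ _ [u uP ->] [w wP ->]|i _].
  - exists 0; first exact: mem0v.
    by apply/ffunP=> j; rewrite !ffunE mxE.
  - exists (u + w); first exact: memvD.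
    by apply/ffunP=> j; rewrite !ffunE mxE.
  - have [u uP ->] := XP i; exists ((coord X i (bose_vec v))%:A *: u).
      exact: memvZ.
    by rewrite bose_vecZ.
rewrite vE bose_vec_sum; apply: memv_suml => i _.
rewrite {1}(coord_vbasis (memvf (coord (vbasis P) i v))) scaler_suml.
rewrite bose_vec_sum; apply: memv_suml => j _.
rewrite -mulr_algl -scalerA bose_vecZ; apply/memvZ/memv_span.
by apply/allpairsP; exists ((vbasis {:L})`_j, (vbasis P)`_i); rewrite /= !mem_nth ?size_tuple.
Qed.

Definition distinct3 (T : eqType) (A B C : T) : Prop :=
  [/\ A <> B, A <> C & B <> C].

Definition collinear (K : fieldType) (vT : vectType K) (A B C : {vspace vT}) :
    Prop :=
  exists2 l : {vspace vT}, \dim l = 2%N & [/\ (A <= l)%VS, (B <= l)%VS & (C <= l)%VS].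

(* The F-subplanes are the images of PG(2, q) under PGL(3, q^3).              *)
Definition Fq_subplane (F : fieldType) (L : fieldExtType F)
    (S : {vspace 'rV[L]_3} -> Prop) : Prop :=
  exists2 M : 'M[L]_3, M \in unitmx &
    forall P, S P <->
      exists2 a : 'rV[F]_3, a != 0 & P = <[map_mx (in_alg L) a *m M]>%VS.

Definition collineation (K : fieldType) (vT : vectType K)
    (phi : {vspace vT} -> {vspace vT}) : Prop :=
  bijective phi /\ forall U W, (phi U <= phi W)%VS = (U <= W)%VS.

Definition order3 (T : Type) (phi : T -> T) : Prop :=
  (forall U, phi (phi (phi U)) = U) /\ exists U, phi U <> U.

(* In coordinates for which the subplane is PG(2, q), phi is the map          *)
(* x |-> x^q (or x |-> x^(q^2)) on coordinates, and the projectivity that it  *)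
(* induces is that same map of L^3, an F-linear map whose cube is the         *)
(* identity. The condition f^3 = 1 is needed: if q = 1 mod 3 and a in L has a *)
(* norm that is not a cube in F, then x |-> a x^q also maps each [[P]] to     *)
(* [[P^phi]] and has order 3 in PGL(9, q), but it has no fixed point.         *)
Definition induced_projectivity (F : fieldType) (L : fieldExtType F)
    (phi : {vspace 'rV[L]_3} -> {vspace 'rV[L]_3})
    (sigma : {vspace bose_space L} -> {vspace bose_space L}) : Prop :=
  (exists2 f : 'End(bose_space L), (f \o f \o f)%VF = \1%VF &
     forall U, sigma U = (f @: U)%VS) /\
  (forall P, \dim P = 1%N -> sigma (bose P) = bose (phi P)).

Definition typeII (F : fieldType) (L : fieldExtType F)
    (phi : {vspace 'rV[L]_3} -> {vspace 'rV[L]_3}) (P : {vspace 'rV[L]_3}) :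
    Prop :=
  distinct3 P (phi P) (phi (phi P)) /\ collinear P (phi P) (phi (phi P)).

Definition type_point (F : fieldType) (L : fieldExtType F)
    (X : {vspace 'rV[L]_3} -> Prop) (A : {vspace bose_space L}) : Prop :=
  \dim A = 1%N /\ exists P, [/\ \dim P = 1%N, X P & (A <= bose P)%VS].

Section FixedSubspaces.

Variables (F : fieldType) (L : fieldExtType F).
(* S is the subplane, that is, the set of the points of Type I.               *)
Variable S : {vspace 'rV[L]_3} -> Prop.
Variable phi : {vspace 'rV[L]_3} -> {vspace 'rV[L]_3}.
Variable sigma : {vspace bose_space L} -> {vspace bose_space L}.

Implicit Types A l pi : {vspace bose_space L}.

Definition fixed_point A : Prop := \dim A = 1%N /\ sigma A = A.

Definition I_collinear_point A : Prop :=
  [/\ type_point S A, distinct3 A (sigma A) (sigma (sigma A))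
    & collinear A (sigma A) (sigma (sigma A))].

Definition II_collinear_point A : Prop :=
  type_point (typeII phi) A /\ collinear A (sigma A) (sigma (sigma A)).

Definition II_triangle_point A : Prop :=
  type_point (typeII phi) A /\ ~ collinear A (sigma A) (sigma (sigma A)).

Definition fixed_I_line l : Prop :=
  [/\ \dim l = 2%N, sigma l = l & exists2 A, I_collinear_point A & (A <= l)%VS].

Definition fixed_II_line l : Prop :=
  [/\ \dim l = 2%N, sigma l = l & exists2 A, II_collinear_point A & (A <= l)%VS].

Definition fixed_II_plane pi : Prop :=
  [/\ \dim pi = 3%N, sigma pi = pi & exists2 A, II_triangle_point A & (A <= pi)%VS].

End FixedSubspaces.

Definition total_number (T : eqType) (X : T -> Prop) (c : int) : Prop :=
  exists s : seq T, [/\ uniq s, forall x, x \in s <-> X x & (size s)%:Z = c].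

Definition contains_exactly (K : fieldType) (vT : vectType K) (pi : {vspace vT})
    (c : int) (X : {vspace vT} -> Prop) : Prop :=
  total_number (fun A => X A /\ (A <= pi)%VS) c.

Definition fixed_II1_plane (F : fieldType) (L : fieldExtType F)
    (S : {vspace 'rV[L]_3} -> Prop)
    (phi : {vspace 'rV[L]_3} -> {vspace 'rV[L]_3})
    (sigma : {vspace bose_space L} -> {vspace bose_space L})
    (q n g : int) (pi : {vspace bose_space L}) : Prop :=
  fixed_II_plane phi sigma pi /\
  [/\ contains_exactly pi g (fixed_point sigma),
      contains_exactly pi (q - n) (I_collinear_point S sigma),
      contains_exactly pi ((g - 1) * (q - n)) (II_collinear_point phi sigma) &
      contains_exactly pi (q ^+ 2 + q + 1 - g * (q - n + 1))
        (II_triangle_point phi sigma)] /\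
  contains_exactly pi 1 (fixed_I_line S sigma) /\
  contains_exactly pi (g - 1) (fixed_II_line phi sigma).

Definition fixed_II2_plane (F : fieldType) (L : fieldExtType F)
    (phi : {vspace 'rV[L]_3} -> {vspace 'rV[L]_3})
    (sigma : {vspace bose_space L} -> {vspace bose_space L})
    (q n g : int) (pi : {vspace bose_space L}) : Prop :=
  fixed_II_plane phi sigma pi /\
  [/\ contains_exactly pi g (fixed_point sigma),
      contains_exactly pi (g * (q - n)) (II_collinear_point phi sigma) &
      contains_exactly pi (q ^+ 2 + q + 1 - g * (q - n + 1))
        (II_triangle_point phi sigma)] /\
  contains_exactly pi g (fixed_II_line phi sigma).

(* Main.v *)
Require Import Defs.
From HB Require Import structures.
From mathcomp Require Import all_boot all_order all_algebra all_fingroup all_solvable all_field.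
From mathcomp Require Import ring zify.

Set Implicit Arguments.
Unset Strict Implicit.
Unset Printing Implicit Defensive.

Import GRing.Theory.
Local Open Scope ring_scope.

(* In coordinates for which the subplane is PG(2, q), Hilbert 90 brings the
   lift f of sigma to the form x |-> tau x on L^3, with tau a generator of
   Gal(L / F). A normal basis of L over F then identifies L^3 with the 3 x 3
   matrices over F, and f with the cyclic shift C of the rows: points of
   Type I, II, III become matrices of rank 1, 2, 3.

   A fixed-II-plane is a cyclic F[C]-module generated by a matrix X of rank 2
   with X, C X, C^2 X independent, hence isomorphic to F[x]/(x^3 - 1). Its
   fixed points and its fixed lines are the kernels and the images of C - w,
   where w^3 = 1. The orbit of any non-fixed point of such a line spans the
   line, so the non-fixed points of a fixed line have one common rank. At most
   one of the g lines has rank 1, and this separates the two types.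

   The planes of the first type are the modules generated by e_w a + e_0 b
   and those of the second type the ones generated by e_0 a + (C e_0) b, where
   a, b are independent rows, e_0 is a basis column and e_w an eigenvector of
   C. The normal form of the second type exists because the 2-dimensional
   column space K of X meets C^-1 K. The totals follow from the fibres of
   these two parametrisations. *)

(** Hilbert 90 applies because f^3 = 1: in coordinates f is x |-> c (tau x), and f^3 = 1 gives c
    norm 1, so that c can be absorbed into the coordinates. The obstacle is that no eigenspace
    decomposition of C serves all q: for q = 0 mod 3 the matrix C is unipotent, and for q = 2 mod 3
    two of its eigenvalues lie outside F. The counts are therefore made with the divisors x - w and
    x^2 + w x + w^2 of x^3 - 1, without splitting the quadratic one. Two equations over F supply the
    numbers: w^3 = 1 has g solutions, which label the fixed points and the fixed lines of a plane,
    and t^2 + t + 1 = 0 has 1 + n, which index the fixed points of one such line, so that q - n of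
    its points are moved. For planes of the first type the fibres of the parametrisation depend on
    the characteristic through a condition s + 3 t <> 0; this is the origin of the factor q - 2 + g
    - n. *)

Section TotalNumber.

Variable T : eqType.
Implicit Types X Y Z : T -> Prop.

Lemma total_number_unique X c d :
  total_number X c -> total_number X d -> c = d.
Proof.
move=> [s [us sX <-]] [t [ut tX <-]]; congr Posz.
apply/perm_size/uniq_perm => // x.
by apply/idP/idP => [/sX/tX|/tX/sX].
Qed.

Lemma eq_total_number X Y c :
  (forall x, X x <-> Y x) -> total_number X c -> total_number Y c.
Proof.
by move=> XY [s [us sX <-]]; exists s; split=> // x; rewrite sX.
Qed.

Lemma total_numberU X Y Z c d :
    (forall x, X x -> Y x -> False) -> (forall x, Z x <-> X x \/ Y x) ->
  total_number X c -> total_number Y d -> total_number Z (c + d).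
Proof.
move=> XY ZE [s [us sX <-]] [t [ut tY <-]]; exists (s ++ t); split.
- rewrite cat_uniq us ut andbT; apply/hasPn => x /tY Yx.
  by apply/negP => /sX /XY; apply.
- by move=> x; rewrite mem_cat ZE -sX -tY; split => /orP.
- by rewrite size_cat PoszD.
Qed.

Lemma total_numberD X Y Z c d :
    (forall x, Y x -> X x) -> (forall x, Z x <-> X x /\ ~ Y x) ->
  total_number X c -> total_number Y d -> total_number Z (c - d).
Proof.
move=> YX ZE [s [us sX <-]] [t [ut tY <-]].
have st : {subset t <= s} by move=> x /tY /YX /sX.
exists [seq x <- s | x \notin t]; split; first exact: filter_uniq.
  move=> x; rewrite mem_filter ZE -sX; split.
    by move=> /andP[/negP xt xs]; split=> // /tY.
  by move=> [xs xY]; rewrite xs andbT; apply/negP => /tY.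
have pt : perm_eq [seq x <- s | x \in t] t.
  apply: uniq_perm => [||x]; rewrite ?filter_uniq // mem_filter.
  by case xt: (x \in t) => //=; apply: st.
have := count_predC (mem t) s.
rewrite -!size_filter (perm_size pt) /= => <-.
by rewrite PoszD addrAC subrr add0r.
Qed.

(** Double counting over the fibres of [h], all of size d. The form #|D| = c * d avoids a division;
    points and planes are parametrised below by vectors only up to such fibres. *)
Lemma total_number_fibres (I : finType) (D : {set I}) (h : I -> T) X (c d : nat) :
    (0 < d)%N -> (forall i, i \in D -> #|[set j in D | h j == h i]| = d) ->
    (forall x, X x <-> exists2 i, i \in D & x = h i) ->
  #|D| = (c * d)%N -> total_number X c.
Proof.
move=> d0 hd XE cD; exists (undup [seq h i | i <- enum D]); split.
- exact: undup_uniq.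
- move=> x; rewrite mem_undup XE; split.
    by move=> /mapP[i]; rewrite mem_enum => iD ->; exists i.
  by move=> [i iD ->]; apply/map_f; rewrite mem_enum.
congr Posz; apply/eqP; rewrite -(eqn_pmul2r d0) -cD; apply/eqP.
rewrite -[RHS]sum1_card.
rewrite (eq_bigl (fun i => (i \in D) && true)); last by move=> i; rewrite andbT.
have -> : (\sum_(i in D | true) 1 = \sum_(x <- undup [seq h i | i <- enum D])
     \sum_(i in D | h i == x) 1)%N.
  rewrite (exchange_big_dep (fun i => i \in D)) //=; last by move=> ? ? _ /andP[].
  rewrite (eq_bigl (fun i => i \in D)); last by move=> i; rewrite andbT.
  apply: eq_bigr => i iD.
  rewrite (eq_bigl (fun x => x == h i)); last by move=> x /=; rewrite iD eq_sym.
  rewrite -big_filter.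
  rewrite (_ : [seq _ <- _ | _] = [:: h i]) ?big_seq1 //.
  have := filter_pred1_uniq (undup_uniq [seq h i | i <- enum D]).
  by apply; rewrite mem_undup map_f ?mem_enum.
rewrite big_seq (eq_bigr (fun=> d)).
  by rewrite -big_seq big_const_seq count_predT iter_addn_0 mulnC.
move=> x; rewrite mem_undup => /mapP[i]; rewrite mem_enum => iD ->.
by rewrite -(hd i iD) sum1dep_card; apply: eq_card => j; rewrite !inE.
Qed.

Lemma total_number_inj (I : finType) (D : {set I}) (h : I -> T) X :
    {in D &, injective h} -> (forall x, X x <-> exists2 i, i \in D & x = h i) ->
  total_number X #|D|.
Proof.
move=> hI XE; apply: (@total_number_fibres I D h X #|D| 1) => //; last first.
  by rewrite muln1.
move=> i iD; rewrite -(cards1 i); congr #|pred_of_set _|; apply/setP=> j; rewrite !inE.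
apply/andP/eqP=> [[jD /eqP]|->]; last by rewrite iD eqxx.
exact: hI.
Qed.

End TotalNumber.

Section Independence.

Variables (K : fieldType) (vT : vectType K).
Implicit Types (u v w : vT) (U : {vspace vT}).

Lemma free2P u v :
  reflect (forall x y, x *: u + y *: v = 0 -> x = 0 /\ y = 0) (free [:: u; v]).
Proof.
apply: (iffP (@freeP _ _ _ [tuple u; v])) => [fr x y xy|fr k].
  have := fr (fun i => [:: x; y]`_i).
  rewrite !big_ord_recl big_ord0 /= addr0 => /(_ xy) E.
  by split; [apply: (E 0)|apply: (E 1)].
rewrite !big_ord_recl big_ord0 /= addr0 => /fr[k0 k1] i.
case: i => [[|[|//]]] lti; [rewrite -k0|rewrite -k1]; congr k; exact: val_inj.
Qed.

Lemma free3P u v w :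
  reflect (forall x y z, x *: u + y *: v + z *: w = 0 -> [/\ x = 0, y = 0 & z = 0])
          (free [:: u; v; w]).
Proof.
apply: (iffP (@freeP _ _ _ [tuple u; v; w])) => [fr x y z xyz|fr k].
  have := fr (fun i => [:: x; y; z]`_i).
  rewrite !big_ord_recl big_ord0 /= addr0 addrA => /(_ xyz) E.
  by split; [apply: (E 0)|apply: (E 1)|apply: (E ord_max)].
rewrite !big_ord_recl big_ord0 /= addr0 addrA => /fr[k0 k1 k2] i.
by case: i => [[|[|[|//]]]] lti; [rewrite -k0|rewrite -k1|rewrite -k2];
  congr k; apply: val_inj.
Qed.

Lemma mem_span2 u v w :
  reflect (exists x y, w = x *: u + y *: v) (w \in <<[:: u; v]>>%VS).
Proof.
rewrite !span_cons span_nil addv0; apply: (iffP memv_addP).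
  move=> [_ /vlineP[x ->] [_ /vlineP[y ->] ->]]; by exists x, y.
by move=> [x [y ->]]; exists (x *: u); [exact/memvZ/memv_line|];
  exists (y *: v) => //; exact/memvZ/memv_line.
Qed.

Lemma mem_span3 u1 u2 u3 w :
  reflect (exists x y z, w = x *: u1 + y *: u2 + z *: u3)
          (w \in <<[:: u1; u2; u3]>>%VS).
Proof.
rewrite span_cons; apply: (iffP memv_addP).
  move=> [_ /vlineP[x ->] [_ /mem_span2[y [z ->]] ->]]; exists x, y, z.
  by rewrite addrA.
move=> [x [y [z ->]]]; exists (x *: u1); first exact/memvZ/memv_line.
by rewrite -addrA; eexists; [|reflexivity]; apply/mem_span2; exists y, z.
Qed.

Lemma dim1_vline U : \dim U = 1%N -> exists2 v, v != 0 & U = <[v]>%VS.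
Proof.
move=> dU; have Un0 : U != 0%VS by rewrite -dimv_eq0 dU.
exists (vpick U); first by rewrite vpick0.
apply/esym/eqP; rewrite eqEdim -memvE memv_pick dU dim_vline.
by rewrite vpick0 Un0.
Qed.

Lemma eq_vlineP u v : v != 0 ->
  reflect (exists2 c, c != 0 & u = c *: v) (<[u]>%VS == <[v]>%VS).
Proof.
move=> v0; apply: (iffP eqP) => [uv|[c c0 ->]].
  have /vlineP[c uE] : u \in <[v]>%VS by rewrite -uv memv_line.
  exists c => //; apply: contraNneq v0 => c0.
  have : v \in <[u]>%VS by rewrite uv memv_line.
  by rewrite uE c0 scale0r => /vlineP[k ->]; rewrite scaler0.
apply/eqP; rewrite eqEdim !dim_vline v0 scaler_eq0 (negPf c0) (negPf v0) andbT.
by rewrite -memvE memvZ ?memv_line.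
Qed.

Lemma dim_vline1 v : v != 0 -> \dim <[v]>%VS = 1%N.
Proof. by move=> v0; rewrite dim_vline v0. Qed.

End Independence.

(** * Orbits of a linear map of order three *)

Section CyclicVectors.

Variables (K : fieldType) (vT : vectType K) (f : 'End(vT)).
Hypothesis f3 : forall v, f (f (f v)) = v.
Implicit Types (v : vT) (w x y z : K).

(** The action on v of x + y T + z T^2 in the commutative algebra K[T] / (T^3 - 1), with T acting as
    f. *)
Definition cact x y z v := x *: v + y *: f v + z *: f (f v).

Definition cyclic3 v := free [:: v; f v; f (f v)].

(** For w^3 = 1 the polynomial T^2 + w T + w^2 is (T^3 - 1) / (T - w), so w names the factor that is
    left out. These are the vectors of the non-fixed points with collinear orbit. *)
Definition quadratic w v :=
  free [:: v; f v] && (f (f v) == - (w *: f v + w ^+ 2 *: v)).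

Lemma f_cact x y z v : f (cact x y z v) = cact z x y v.
Proof. by rewrite /cact !linearD !linearZ /= f3 addrC addrA. Qed.

Lemma cactD x y z x' y' z' v :
  cact x y z v + cact x' y' z' v = cact (x + x') (y + y') (z + z') v.
Proof. by rewrite /cact !scalerDl addrACA (addrACA (x *: v)). Qed.

Lemma cactZ c x y z v : c *: cact x y z v = cact (c * x) (c * y) (c * z) v.
Proof. by rewrite /cact !scalerDr !scalerA. Qed.

Lemma cactN x y z v : - cact x y z v = cact (- x) (- y) (- z) v.
Proof. by rewrite /cact !opprD !scaleNr. Qed.

Lemma cact1 v : v = cact 1 0 0 v.
Proof. by rewrite /cact !scale0r !addr0 scale1r. Qed.

(** The coefficients are those of the product modulo T^3 - 1; commutation of operators thus becomes
    a [ring] identity. *)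
Lemma cact_cact x y z x' y' z' v : cact x y z (cact x' y' z' v) =
  cact (x * x' + y * z' + z * y') (x * y' + y * x' + z * z')
      (x * z' + y * y' + z * x') v.
Proof. by rewrite {1}/cact !f_cact !cactZ !cactD. Qed.

Lemma cyclic3P v :
  reflect (forall x y z, cact x y z v = 0 -> [/\ x = 0, y = 0 & z = 0]) (cyclic3 v).
Proof. exact: free3P. Qed.

Lemma cact_inj v x y z x' y' z' : cyclic3 v ->
  cact x y z v = cact x' y' z' v -> [/\ x = x', y = y' & z = z'].
Proof.
move=> /cyclic3P cv /eqP; rewrite -subr_eq0 cactN cactD => /eqP /cv[].
by split; apply/eqP; rewrite -subr_eq0; apply/eqP.
Qed.

(* The characteristic polynomial of the restriction of f to the span of
   the orbit divides X^3 - 1, and a monic quadratic divisor of X^3 - 1 with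
   complementary root w is X^2 + w X + w^2. *)
Lemma cyclic_trichotomy v : v != 0 ->
  [\/ exists2 w, w ^+ 3 = 1 & f v = w *: v,
      exists2 w, w ^+ 3 = 1 & quadratic w v
    | cyclic3 v].
Proof.
move=> v0; case: (boolP (cyclic3 v)) => c3; first by constructor 3.
case: (boolP (free [:: v; f v])) => c2.
  constructor 2.
  have /mem_span2[s [t E]] : f (f v) \in <<[:: v; f v]>>%VS.
    apply: contraNT c3 => nin; rewrite /cyclic3 (perm_free (Y := [:: f (f v); v; f v])).
      by rewrite free_cons nin.
    by rewrite -[X in perm_eq X]/([:: v; f v] ++ [:: f (f v)]) perm_catC.
  (* Applying f to f (f v) = s v + t (f v) gives v = t s v + (s + t^2) (f v), so s = - t^2 and t^3 =
     -1; the complementary root is - t. *)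
  have [|E1 E2] := elimT (free2P v (f v)) c2 (t * s - 1) (s + t ^+ 2).
    have E3 : f (f (f v)) = (t * s) *: v + (s + t ^+ 2) *: f v.
      rewrite {1}E linearD !linearZ /= E scalerDr !scalerA scalerDl -expr2.
      by rewrite addrCA.
    by rewrite scalerBl scale1r addrAC -E3 f3 subrr.
  have s2 : s = - t ^+ 2 by apply/eqP; rewrite -addr_eq0 E2.
  have t3 : t ^+ 3 = -1.
    by apply/eqP; rewrite -addr_eq0 -oppr_eq0 -E1 s2; apply/eqP; ring.
  exists (- t); first by rewrite exprNn t3; ring.
  by rewrite /quadratic c2 E s2 sqrrN !scaleNr opprD opprK addrC eqxx.
constructor 1.
have /vlineP[w E] : f v \in <[v]>%VS.
  apply: contraNT c2 => nin; rewrite (perm_free (Y := [:: f v; v])).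
    by rewrite free_cons span_seq1 nin seq1_free.
  by rewrite -[[:: v; _]]/([:: v] ++ [:: f v]) perm_catC.
exists w => //; apply/eqP; rewrite -subr_eq0; apply: contraNT v0 => nz.
rewrite -(inj_eq (scalerI nz)) scaler0 scalerBl scale1r.
have Ew : w ^+ 3 *: v = v.
  rewrite -[RHS]f3 E linearZ /= E linearZ /= linearZ /= E !scalerA.
  by congr (_ *: _); ring.
by rewrite Ew subrr.
Qed.

End CyclicVectors.

Lemma forall_ord3 (P : 'I_3 -> Prop) : P 0 -> P 1 -> P 2%:R -> forall i, P i.
Proof.
move=> P0 P1 P2 i; case: i => [[|[|[|//]]]] lti.
- by rewrite (_ : Ordinal lti = 0) //; apply: val_inj.
- by rewrite (_ : Ordinal lti = 1) //; apply: val_inj.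
- by rewrite (_ : Ordinal lti = 2%:R) //; apply: val_inj.
Qed.

Lemma big_ord3 (V : nmodType) (G : 'I_3 -> V) :
  \sum_i G i = G 0 + G 1 + G 2%:R.
Proof.
rewrite !big_ord_recl big_ord0 addr0 addrA.
by congr (_ + G _ + G _); apply: val_inj.
Qed.

(** * Matrices of order 3 under the cyclic shift of rows, and the two normal forms *)

Section ShiftMatrix.

Variable F : fieldType.
Implicit Types (a b u v : 'rV[F]_3) (X Y : 'M[F]_3) (w x y z : F).

Definition mk u0 u1 u2 : 'M[F]_3 := \matrix_(i < 3) [:: u0; u1; u2]`_i.

(* The rows of X are the F-coordinates, in a normal basis b, tau b, tau^2 b,
   of a vector of L^3; multiplication by [shift] on the left is then tau. *)
Definition shift : 'M[F]_3 := \matrix_(i, j) (i == j + 1)%:R.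

Local Notation C := shift.

(** Left multiplication by the circulant matrix x + y C + z C^2, the counterpart of [cact]. *)
Definition circ x y z X := x *: X + y *: (C *m X) + z *: (C *m (C *m X)).

Definition indep a b := row_free (col_mx a b).

Lemma mkE X : X = mk (row 0 X) (row 1 X) (row 2%:R X).
Proof.
by apply/row_matrixP; apply: forall_ord3; rewrite rowK.
Qed.

Lemma mk_inj u0 u1 u2 v0 v1 v2 :
  mk u0 u1 u2 = mk v0 v1 v2 -> [/\ u0 = v0, u1 = v1 & u2 = v2].
Proof.
move=> E; split.
- by have := congr1 (row 0) E; rewrite !rowK.
- by have := congr1 (row 1) E; rewrite !rowK.
- by have := congr1 (row 2%:R) E; rewrite !rowK.
Qed.

Lemma mk0 : mk 0 0 0 = 0.
Proof.
by apply/row_matrixP; apply: forall_ord3; rewrite rowK row0.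
Qed.

Lemma mkD u0 u1 u2 v0 v1 v2 :
  mk u0 u1 u2 + mk v0 v1 v2 = mk (u0 + v0) (u1 + v1) (u2 + v2).
Proof.
by apply/row_matrixP; apply: forall_ord3; rewrite linearD /= !rowK.
Qed.

Lemma mkZ x u0 u1 u2 : x *: mk u0 u1 u2 = mk (x *: u0) (x *: u1) (x *: u2).
Proof.
by apply/row_matrixP; apply: forall_ord3; rewrite linearZ /= !rowK.
Qed.

Lemma mulmx_mk (k : 'rV[F]_3) u0 u1 u2 :
  k *m mk u0 u1 u2 = k 0 0 *: u0 + k 0 1 *: u1 + k 0 2%:R *: u2.
Proof. by apply/rowP => j; rewrite !mxE big_ord3 !mxE. Qed.

Lemma shift_mk u0 u1 u2 : C *m mk u0 u1 u2 = mk u2 u0 u1.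
Proof.
apply/matrixP => i j; move: i; apply: forall_ord3;
by rewrite !mxE !big_ord_recl big_ord0 !mxE /= !(mul0r, mul1r, addr0, add0r).
Qed.

Lemma shift3 X : C *m (C *m (C *m X)) = X.
Proof. by rewrite (mkE X) !shift_mk. Qed.

Lemma circ_mk x y z u0 u1 u2 : circ x y z (mk u0 u1 u2) =
  mk (x *: u0 + y *: u2 + z *: u1) (x *: u1 + y *: u0 + z *: u2)
     (x *: u2 + y *: u1 + z *: u0).
Proof. by rewrite /circ !shift_mk !mkZ !mkD. Qed.

Lemma circ_sub x y z X : (circ x y z X <= X)%MS.
Proof. by rewrite /circ !addmx_sub ?scalemx_sub ?mulmxA ?submxMl. Qed.

Lemma mk_subP n u0 u1 u2 (B : 'M[F]_(n, 3)) :
  reflect [/\ (u0 <= B)%MS, (u1 <= B)%MS & (u2 <= B)%MS] (mk u0 u1 u2 <= B)%MS.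
Proof.
apply: (iffP row_subP) => [sB|[s0 s1 s2]].
  by have := (sB 0, sB 1, sB 2%:R); rewrite !rowK => -[[]].
by apply: forall_ord3; rewrite rowK.
Qed.

Lemma row_mk_sub u0 u1 u2 :
  [/\ (u0 <= mk u0 u1 u2)%MS, (u1 <= mk u0 u1 u2)%MS & (u2 <= mk u0 u1 u2)%MS].
Proof. exact/mk_subP. Qed.

Lemma indepP a b :
  reflect (forall x y, x *: a + y *: b = 0 -> x = 0 /\ y = 0) (indep a b).
Proof.
apply: (iffP idP) => [fr x y xy|ind].
  have : row_mx x%:M y%:M *m col_mx a b = 0 *m col_mx a b.
    by rewrite mul_row_col !mul_scalar_mx xy mul0mx.
  move/(row_free_inj fr) => E.
  have := (congr1 lsubmx E, congr1 rsubmx E).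
  rewrite row_mxKl row_mxKr !linear0 => -[E1 E2]; split.
    by have := congr1 (fun A : 'M_1 => A 0 0) E1; rewrite !mxE mulr1n.
  by have := congr1 (fun A : 'M_1 => A 0 0) E2; rewrite !mxE mulr1n.
apply: inj_row_free => r; rewrite -[r]hsubmxK mul_row_col.
rewrite [lsubmx r]mx11_scalar [rsubmx r]mx11_scalar !mul_scalar_mx => /ind[-> ->].
by rewrite !raddf0 row_mx0.
Qed.

Lemma indep_neq0 a b : indep a b -> a != 0 /\ b != 0.
Proof.
move=> /indepP ind; split; apply/eqP => E.
  by have [|/eqP] := ind 1 0; rewrite ?E ?scaler0 ?scale0r ?addr0 ?oner_eq0.
by have [|_ /eqP] := ind 0 1; rewrite ?E ?scaler0 ?scale0r ?addr0 ?oner_eq0.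
Qed.

Lemma indep_eq a b x y x' y' : indep a b ->
  x *: a + y *: b = x' *: a + y' *: b -> x = x' /\ y = y'.
Proof.
move=> /indepP ind E; have [|/eqP + /eqP] := ind (x - x') (y - y').
  by rewrite !scalerBl addrACA E -opprD subrr.
by rewrite !subr_eq0 => /eqP-> /eqP->.
Qed.

Lemma rank_indep a b X : indep a b -> (a <= X)%MS -> (b <= X)%MS ->
  (2 <= \rank X)%N.
Proof.
move=> /eqP r2 aX bX.
have : (\rank (col_mx a b) <= \rank X)%N by apply: mxrankS; rewrite col_mx_sub aX.
by rewrite r2.
Qed.

Lemma indep_rank a b X : (2 <= \rank X)%N -> (X <= col_mx a b)%MS -> indep a b.
Proof.
move=> rX /mxrankS rXab; rewrite /indep /row_free eqn_leq rank_leq_row /=.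
exact: leq_trans rXab.
Qed.

Lemma rank_sub2 a b X : (X <= col_mx a b)%MS -> (\rank X <= 2)%N.
Proof. by move/mxrankS/leq_trans; apply; exact: rank_leq_row. Qed.

Lemma rank_sub1 b X : (X <= b)%MS -> (\rank X <= 1)%N.
Proof. by move/mxrankS/leq_trans; apply; exact: rank_leq_row. Qed.

Lemma rank1_sub X : (\rank X <= 1)%N -> exists2 b : 'rV[F]_3, (b <= X)%MS & (X <= b)%MS.
Proof.
move=> rX; have [X0|Xn0] := eqVneq X 0.
  by exists 0; rewrite ?X0 ?sub0mx.
exists (nz_row X); first exact: nz_row_sub.
rewrite -(geq_leqif (mxrank_leqif_sup (nz_row_sub X))).
by rewrite (leq_trans rX) // lt0n mxrank_eq0 nz_row_eq0.
Qed.

(** The equation makes every row a multiple of row 1. Consequently fixed points are of Type I. *)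
Lemma rank_eigen w X : C *m X = w *: X -> (\rank X <= 1)%N.
Proof.
rewrite (mkE X) shift_mk mkZ => /mk_inj[E0 E1 E2].
apply: (@rank_sub1 (row 1 X)); apply/mk_subP; split=> //.
  by rewrite E1 scalemx_sub.
by rewrite E0 E1 !scalemx_sub.
Qed.

Definition mcyclic X := forall x y z, circ x y z X = 0 -> [/\ x = 0, y = 0 & z = 0].

Definition mshift w X := C *m X - w *: X.

(** The matrix Z = (C - w) (C - w') X is nonzero by cyclicity, and its row space lies in those of (C
    - w) X and (C - w') X. Having rank at most 1, both share the row space of Z, and X is a multiple
    of their difference. *)
Lemma two_rank1_shifts w w' X : mcyclic X -> w != w' ->
    (\rank (mshift w X) <= 1)%N -> (\rank (mshift w' X) <= 1)%N ->
  (\rank X <= 1)%N.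
Proof.
move=> cX ww'; rewrite /mshift.
set Y := C *m X - w *: X; set Y' := _ - w' *: X => rY rY'.
pose Z := C *m Y - w' *: Y.
have ZE : Z = C *m Y' - w *: Y'.
  rewrite /Z /Y /Y' !mulmxBr -!scalemxAr; move: (C *m (C *m X)) (C *m X) => X2 X1.
  by apply/matrixP => i j; rewrite !mxE; ring.
have Z0 : Z != 0.
  apply/eqP => Z0; have [] := cX (w * w') (- (w + w')) 1.
    rewrite -Z0 /Z /circ /Y mulmxBr -scalemxAr.
    move: (C *m (C *m X)) (C *m X) => X2 X1.
    by apply/matrixP => i j; rewrite !mxE; ring.
  by move=> _ _ /eqP; rewrite oner_eq0.
have sub (A : 'M[F]_3) x : (mshift x A <= A)%MS.
  by rewrite addmx_sub ?submxMl // -scaleNr scalemx_sub.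
have leZ (A : 'M[F]_3) : (Z <= A)%MS -> (\rank A <= 1)%N -> (A <= Z)%MS.
  move=> ZA rA; rewrite -(geq_leqif (mxrank_leqif_sup ZA)) (leq_trans rA) //.
  by rewrite lt0n mxrank_eq0.
have YZ : (Y <= Z)%MS by apply: leZ rY; apply: sub.
have YZ' : (Y' <= Z)%MS by apply: leZ rY'; rewrite ZE; apply: sub.
have XE : X = (w' - w)^-1 *: (Y - Y').
  rewrite /Y /Y'; move: (C *m X) => X1; apply/matrixP => i j; rewrite !mxE.
  by field; rewrite subr_eq0 eq_sym.
have /mxrankS : (X <= Z)%MS.
  by rewrite XE scalemx_sub // addmx_sub // -scaleN1r scalemx_sub.
by move/leq_trans; apply; apply: leq_trans (mxrankS (sub Y w')) rY.
Qed.

(** This is e_w a + e_0 b with e_w = (1, w^2, w)^T, the eigenvector of C for w when w^3 = 1. As C -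
    w kills e_w, it leaves only ((C - w) e_0) b, of rank at most 1. *)
Definition mk1 w a b := mk (a + b) (w ^+ 2 *: a) (w *: a).

Definition mk2 a b := mk a b 0.

(** The circulant x + y C + z C^2 sends [mk1 w a b] to (x + w y + w^2 z) e_w a + (x, y, z)^T b; the
    coefficients of b alone force x = y = z = 0. *)
Lemma mk1_gen w a b : w ^+ 3 = 1 -> indep a b ->
  [/\ mcyclic (mk1 w a b), \rank (mk1 w a b) = 2%N
    & (\rank (mshift w (mk1 w a b)) <= 1)%N].
Proof.
move=> w3 ind; have w0 : w != 0.
  by apply: contra_eq_neq w3 => ->; rewrite expr0n eq_sym oner_eq0.
split.
- move=> x y z; rewrite circ_mk -mk0 => /mk_inj[E0 E1 E2].
  have [|P0 Px] := elimT (indepP a b) ind (x + w * y + w ^+ 2 * z) x.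
    by rewrite -E0; apply/rowP => i; rewrite !mxE; ring.
  have [|_ Py] := elimT (indepP a b) ind (w ^+ 2 * (x + w * y + w ^+ 2 * z)) y.
    rewrite -E1; apply/rowP => i; rewrite !mxE.
    rewrite (_ : w ^+ 2 * _ = w ^+ 2 * x + w ^+ 3 * y + w ^+ 3 * w * z); last by ring.
    by rewrite w3; ring.
  have [|_ Pz] := elimT (indepP a b) ind (w * (x + w * y + w ^+ 2 * z)) z.
    rewrite -E2; apply/rowP => i; rewrite !mxE.
    rewrite (_ : w * _ = w * x + w ^+ 2 * y + w ^+ 3 * z); last by ring.
    by rewrite w3; ring.
  by [].
- apply/eqP; rewrite eqn_leq.
  have [s0 _ s2] := row_mk_sub (a + b) (w ^+ 2 *: a) (w *: a).
  have sa : (a <= mk1 w a b)%MS.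
    by rewrite -[X in (X <= _)%MS]scale1r -(mulVf w0) -scalerA scalemx_sub.
  have sb : (b <= mk1 w a b)%MS.
    by rewrite -[X in (X <= _)%MS](addKr a) addrC addmx_sub // -scaleN1r scalemx_sub.
  rewrite (rank_indep ind) // andbT (@rank_sub2 a b) //.
  have : (col_mx a b <= col_mx a b)%MS by [].
  rewrite {1}col_mx_sub => /andP[aab bab].
  by apply/mk_subP; split; rewrite ?scalemx_sub ?addmx_sub.
- apply: (@rank_sub1 b); rewrite /mshift /mk1 shift_mk -scaleNr mkZ mkD.
  apply/mk_subP; split; apply/sub_rVP; [exists (- w)|exists 1|exists 0];
    apply/rowP => i; rewrite !mxE; last by ring.
    by ring.
  by rewrite (_ : - w * _ = - w ^+ 3 * a 0 i); [rewrite w3; ring|ring].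
Qed.

(** For the last claim, (C - w) (e_0 a + (C e_0) b) has the rows - w a, a - w b and b, whose span
    contains a and b when w is nonzero. *)
Lemma mk2_gen a b : indep a b ->
  [/\ mcyclic (mk2 a b), \rank (mk2 a b) = 2%N
    & forall w, w != 0 -> (2 <= \rank (mshift w (mk2 a b)))%N].
Proof.
move=> ind; split.
- move=> x y z; rewrite circ_mk !scaler0 !(addr0, add0r) -mk0 => /mk_inj[E0 E1 E2].
  have [-> _] := elimT (indepP a b) ind _ _ E0.
  by rewrite addrC in E2; have [-> ->] := elimT (indepP a b) ind _ _ E2.
- apply/eqP; rewrite eqn_leq.
  have [s0 s1 _] := row_mk_sub a b 0.
  rewrite (rank_indep ind) // andbT (@rank_sub2 a b) //.
  have : (col_mx a b <= col_mx a b)%MS by [].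
  rewrite {1}col_mx_sub => /andP[aab bab].
  by apply/mk_subP; split; rewrite ?sub0mx.
- move=> w w0; rewrite /mshift /mk2 shift_mk -scaleNr mkZ mkD scaler0 addr0 add0r.
  set X := mk _ _ _; have [s0 _ s2] := row_mk_sub (- w *: a) (a - w *: b) b.
  rewrite -scaleNr in s0 s2; apply: (rank_indep ind) => //.
  by rewrite -[a]scale1r -(mulVf (_ : - w != 0)) ?oppr_eq0 // -scalerA scalemx_sub.
Qed.

(** The left-hand side has third row 0, while the circulant produces y b' + z a' there. So y = z =
    0, and only a scalar relates two generators of this form. *)
Lemma mk2_fibre a b a' b' x y z : indep a' b' ->
  mk2 a b = circ x y z (mk2 a' b') -> a = x *: a' /\ b = x *: b'.
Proof.
move=> ind; rewrite circ_mk !scaler0 !(addr0, add0r) => /mk_inj[-> -> /esym E2].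
rewrite addrC in E2; have [-> ->] := elimT (indepP a' b') ind _ _ E2.
by rewrite !scale0r !addr0.
Qed.

(** The circulant produces (x + w y + w^2 z) e_w a' + (x, y, z)^T b'. For this to be e_w a + e_0 b,
    the column (x, y, z)^T must be t e_w + s e_0. The functional (1, w, w^2) takes the value 3 on
    e_w and 1 on e_0, whence the coefficient s + 3 t. *)
Lemma mk1_fibre w a b a' b' x y z : w ^+ 3 = 1 -> indep a' b' ->
    mk1 w a b = circ x y z (mk1 w a' b') ->
  exists s t, a = (s + 3%:R * t) *: a' + t *: b' /\ b = s *: b'.
Proof.
move=> w3 ind; rewrite circ_mk => /mk_inj[E0 E1 E2].
have w31 : w * w ^+ 2 = 1 by rewrite -exprS.
have a1 : a = (x + w * y + w ^+ 2 * z) *: a' + (w * y) *: b'.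
  rewrite -[a]scale1r -w31 -scalerA E1; apply/rowP => i; rewrite !mxE.
  rewrite (_ : w * _ = w ^+ 3 * x * a' 0 i + w ^+ 2 * z * a' 0 i +
    w * y * (a' 0 i + b' 0 i)); last ring.
  by rewrite w3; ring.
have a2 : a = (x + w * y + w ^+ 2 * z) *: a' + (w ^+ 2 * z) *: b'.
  rewrite (_ : a = w ^+ 2 *: (w *: a)); last by rewrite scalerA -exprSr w3 scale1r.
  rewrite E2; apply/rowP => i; rewrite !mxE.
  rewrite (_ : w ^+ 2 * _ = w ^+ 3 * (x * a' 0 i + w * y * a' 0 i) +
    w ^+ 2 * z * (a' 0 i + b' 0 i)); last ring.
  by rewrite w3; ring.
(* Rows 1 and 2 both determine a, and their agreement gives w y = w^2 z; this common value is t. *)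
have [_ yz] := indep_eq ind (etrans (esym a1) a2).
exists (x - w * y), (w * y); rewrite {1}a1 -yz; split.
  by congr (_ *: _ + _); ring.
have -> : b = (a + b) - a by rewrite addrC addKr.
by rewrite E0 a1; apply/rowP => i; rewrite !mxE; ring.
Qed.

Lemma mk1_fibre_inv w a b s t : w ^+ 3 = 1 ->
  mk1 w ((s + 3%:R * t) *: a + t *: b) (s *: b) =
  circ (s + t) (w ^+ 2 * t) (w * t) (mk1 w a b).
Proof.
move=> w3; rewrite circ_mk; congr mk; apply/rowP => i; rewrite !mxE.
- rewrite (_ : w ^+ 2 * t * _ = w ^+ 3 * t * a 0 i); last by ring.
  rewrite (_ : w * t * _ = w ^+ 3 * t * a 0 i); last by ring.
  by rewrite w3; ring.
- rewrite (_ : w * t * _ = w ^+ 2 * t * a 0 i); last by ring.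
  by ring.
- rewrite (_ : w ^+ 2 * t * _ = w ^+ 3 * (w * t * a 0 i)); last by ring.
  by rewrite w3; ring.
Qed.

(* Write (C - w) X as (k0, k1, k2)^T b. Then X = (1, w^2, w)^T (u0 - y b) + p b
   for every y, where the column p takes the value 3 y + w^2 k0 - k1 under the
   functional (1, w, w^2) that vanishes on the image of C - w. *)
Lemma mk1_surj w X : w ^+ 3 = 1 -> mcyclic X -> (\rank (mshift w X) <= 1)%N ->
  exists a b x y z, X = circ x y z (mk1 w a b).
Proof.
move=> w3 cX rY.
have w0 : w != 0 by apply: contra_eq_neq w3 => ->; rewrite expr0n eq_sym oner_eq0.
have [b _ sY] := rank1_sub rY.
move: cX sY; rewrite (mkE X) /mshift shift_mk -scaleNr mkZ mkD.
move: (row 0 X) (row 1 X) (row 2%:R X) => u0 u1 u2 cX.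
move=> /mk_subP[/sub_rVP[k0 E0] /sub_rVP[k1 E1] /sub_rVP[k2 E2]].
have u1E : u1 = w ^+ 2 *: (u0 - k1 *: b).
  rewrite -E1; apply/rowP => i; rewrite !mxE.
  rewrite (_ : w ^+ 2 * _ = w ^+ 3 * u1 0 i); last by ring.
  by rewrite w3 mul1r.
have u2E : u2 = w *: u0 + k0 *: b by rewrite -E0; apply/rowP => i; rewrite !mxE; ring.
have [y x0] : exists y, 3%:R * y + (w ^+ 2 * k0 - k1) != 0.
  (* If w^2 k0 = k1, then y = 1 gives the value 3. Were 3 = 0 in F, then (C - w)^2 X = 0, with
     coefficients w^2, - 2 w, 1, against cyclicity. *)
  have [x0|] := eqVneq (w ^+ 2 * k0 - k1) 0; last by exists 0; rewrite mulr0 add0r.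
  exists 1; rewrite x0 addr0 mulr1; apply/eqP => c3.
  have k1E : k1 = w ^+ 2 * k0 by apply/esym/eqP; rewrite -subr_eq0 x0.
  have [|_ _ /eqP] := cX (w ^+ 2) (- (2%:R * w)) 1; last by rewrite oner_eq0.
  rewrite circ_mk -mk0 u2E u1E k1E; congr mk; apply/rowP => i; rewrite !mxE.
  - rewrite (_ : _ + _ + _ = - (3%:R * w * k0 * b 0 i)); first by rewrite c3 !mul0r oppr0.
    by ring: w3.
  - by ring: w3.
  - rewrite (_ : _ + _ + _ = 3%:R * w ^+ 2 * k0 * b 0 i); first by rewrite c3 !mul0r.
    by ring: w3.
set x := 3%:R * y + _ in x0.
(* The entries of p divided by x bring the functional to 1 ([PE]). As coefficients of a circulant
   they fix e_w and send e_0 (x b) to p b. *)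
have [x' xx'] : exists x', x * x' = y by exists (x^-1 * y); rewrite mulVKf.
have [y' xy'] : exists y', x * y' = w ^+ 2 * (y - k1).
  by exists (x^-1 * (w ^+ 2 * (y - k1))); rewrite mulVKf.
have [z' xz'] : exists z', x * z' = w * y + k0.
  by exists (x^-1 * (w * y + k0)); rewrite mulVKf.
have PE : x' + w * y' + w ^+ 2 * z' = 1.
  apply: (mulfI x0); rewrite mulr1.
  rewrite (_ : x * _ = x * x' + w * (x * y') + w ^+ 2 * (x * z')); last by ring.
  by rewrite xx' xy' xz' /x; ring: w3.
exists (u0 - y *: b), (x *: b), x', y', z'.
rewrite circ_mk u1E u2E; congr mk; apply/rowP => i; rewrite !mxE.
- rewrite [RHS](_ : _ = (x' + w * y' + w ^+ 2 * z') * (u0 0 i - y * b 0 i) +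
    x * x' * b 0 i); last by ring.
  by rewrite PE xx'; ring.
- rewrite [RHS](_ : _ = w ^+ 2 * (x' + w * y' + w ^+ 2 * z') * (u0 0 i - y * b 0 i) +
    x * y' * b 0 i); last by ring: w3.
  by rewrite PE xy'; ring.
- rewrite [RHS](_ : _ = w * (x' + w * y' + w ^+ 2 * z') * (u0 0 i - y * b 0 i) +
    x * z' * b 0 i); last by ring: w3.
  by rewrite PE xz'; ring.
Qed.

(* The column space K of X has dimension 2, so some l <> 0 in K has C l in K. If l
   and C l are independent, they form a basis of K; otherwise l is an
   eigenvector of C in K, and C - w drops the rank of X. *)
Lemma mk2_surj X : \rank X = 2%N ->
    (forall w, w ^+ 3 = 1 -> (2 <= \rank (mshift w X))%N) ->
  exists a b x y z, X = circ x y z (mk2 a b).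
Proof.
move=> rX rY.
have C3 : C *m (C *m C) = 1%:M by have := shift3 1%:M; rewrite mulmx1.
have uC : C \in unitmx by case/mulmx1_unit: C3.
have CT3 : C^T *m (C^T *m C^T) = 1%:M.
  by rewrite -!trmx_mul -[X in X^T]mulmxA C3 trmx1.
have uCT : C^T \in unitmx by rewrite unitmx_tr.
(* Columns of X become rows of [K], so [K *m invmx C^T] stands for C^-1 applied to the column
   space. *)
pose K := X^T.
have rK : \rank K = 2%N by rewrite mxrank_tr.
have rK' : \rank (K *m invmx C^T) = 2%N.
  by rewrite mxrankMfree // row_free_unit unitmx_inv.
have capn0 : (K :&: K *m invmx C^T)%MS != 0.
  rewrite -mxrank_eq0 -lt0n.
  have := mxrank_sum_cap K (K *m invmx C^T).
  have := rank_leq_col (K + K *m invmx C^T)%MS.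
  rewrite rK rK'; lia.
pose l := nz_row (K :&: K *m invmx C^T)%MS.
have l0 : l != 0 by rewrite nz_row_eq0.
have : (l <= K :&: K *m invmx C^T)%MS by apply: nz_row_sub.
rewrite sub_capmx => /andP[lK lK'].
have mK : (l *m C^T <= K)%MS.
  by have := submxMr C^T lK'; rewrite mulmxKV.
have [ind|dep] := boolP (indep l (l *m C^T)); last first.
  have /sub_rVP[w lw] : (l *m C^T <= l)%MS.
    have sl : (l <= col_mx l (l *m C^T))%MS.
      by have := submx_refl (col_mx l (l *m C^T)); rewrite {1}col_mx_sub => /andP[].
    have : (col_mx l (l *m C^T) <= l)%MS; last by rewrite col_mx_sub => /andP[].
    rewrite -(geq_leqif (mxrank_leqif_sup sl)) rank_rV l0.
    by rewrite -ltnS ltn_neqAle rank_leq_row andbT.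
  have w3 : w ^+ 3 = 1.
    apply/eqP; rewrite -subr_eq0; apply: contraNT l0 => nz.
    rewrite -(inj_eq (scalerI nz)) scaler0 scalerBl scale1r subr_eq0.
    rewrite -{2}[l]mulmx1 -CT3 !mulmxA !(lw, =^~scalemxAl) !scalerA.
    by apply/eqP; congr (_ *: _); ring.
  have := rY w w3; rewrite -mxrank_tr /mshift linearB /= trmx_mul linearZ /= -/K.
  rewrite -mul_mx_scalar -mulmxBr.
  have := mxrank_mul_ker K (C^T - w%:M); rewrite rK.
  suff : (0 < \rank (K :&: kermx (C^T - w%:M)))%N.
    have ar (r1 r2 : nat) : (0 < r2)%N -> (r1 + r2 = 2)%N -> (1 < r1)%N -> False by lia.
    by move=> r2 r12 /(ar _ _ r2 r12).
  have /mxrankS : (l <= K :&: kermx (C^T - w%:M))%MS.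
    rewrite sub_capmx lK; apply/sub_kermxP.
    by rewrite mulmxBr lw mul_mx_scalar subrr.
  by rewrite rank_rV l0.
have : (K <= col_mx l (l *m C^T))%MS.
  have sK : (col_mx l (l *m C^T) <= K)%MS by rewrite col_mx_sub lK.
  by rewrite -(geq_leqif (mxrank_leqif_sup sK)) rK (eqP ind).
move=> /submxP[T KT].
(* The column l^T is (l_0 + l_1 C + l_2 C^2) e_0, so the circulant with these coefficients carries
   e_0 a + (C e_0) b to l^T a + (C l^T) b, which is X when a and b are read off from the two columns
   of T. *)
exists (row 0 (lsubmx T)^T), (row 0 (rsubmx T)^T), (l 0 0), (l 0 1), (l 0 2%:R).
rewrite -[X]trmxK -/K KT -[T in LHS]hsubmxK mul_row_col circ_mk.
apply/matrixP => i j; move: i; apply: forall_ord3;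
  rewrite !mxE !big_ord1 !mxE !big_ord3 !mxE /=; ring.
Qed.

End ShiftMatrix.

(** * The plane spanned by a cyclic orbit: its fixed points and fixed lines *)

Section CyclicPlane.

Variables (F : fieldType) (vT : vectType F) (f : 'End(vT)).
Hypothesis f3 : forall v, f (f (f v)) = v.
Implicit Types (v u : vT) (w x y z t : F) (o : option F).

Local Notation cact := (cact f).
Local Notation cyclic3 := (cyclic3 f).
Local Notation quadratic := (quadratic f).

Definition orbit_plane v := <<[:: v; f v; f (f v)]>>%VS.

Definition orbit_line v := <<[:: v; f v]>>%VS.

Lemma f_inj : injective f.
Proof. by move=> u v E; rewrite -(f3 u) E f3. Qed.

Lemma mem_orbit_plane v u :
  reflect (exists x y z, u = cact x y z v) (u \in orbit_plane v).
Proof. exact: mem_span3. Qed.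

Lemma cact_mem v x y z : cact x y z v \in orbit_plane v.
Proof. by apply/mem_orbit_plane; exists x, y, z. Qed.

Lemma orbit_plane_id v : v \in orbit_plane v.
Proof. by rewrite {1}(cact1 f v) cact_mem. Qed.

Lemma orbit_line_id v : v \in orbit_line v.
Proof. by apply/mem_span2; exists 1, 0; rewrite scale1r scale0r addr0. Qed.

Lemma orbit_line_f v : f v \in orbit_line v.
Proof. by apply/mem_span2; exists 0, 1; rewrite scale1r scale0r add0r. Qed.

Lemma orbit_plane_f v u : u \in orbit_plane v -> f u \in orbit_plane v.
Proof. by move=> /mem_orbit_plane[x [y [z ->]]]; rewrite f_cact // cact_mem. Qed.

Lemma orbit_plane_sub v u : u \in orbit_plane v -> (orbit_plane u <= orbit_plane v)%VS.
Proof.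
move=> uv; apply/span_subvP => w; rewrite !inE => /or3P[]/eqP-> //;
  by do ?apply: orbit_plane_f.
Qed.

Lemma dim_orbit_plane v : cyclic3 v -> \dim (orbit_plane v) = 3%N.
Proof. by move/eqP. Qed.

Lemma orbit_plane_eq v u : cyclic3 u -> cyclic3 v -> u \in orbit_plane v ->
  orbit_plane u = orbit_plane v.
Proof.
move=> cu cv uv; apply/eqP.
by rewrite eqEdim !dim_orbit_plane // orbit_plane_sub.
Qed.

Lemma limg_fixedE U : (f @: U)%VS = U <-> (f @: U <= U)%VS.
Proof.
split=> [->//|sU]; apply/eqP; rewrite eqEdim sU /= limg_dim_eq //.
rewrite (_ : lker f = 0%VS) ?capv0 //; apply/eqP/lker0P; exact: f_inj.
Qed.

Lemma limg_orbit_plane v : (f @: orbit_plane v)%VS = orbit_plane v.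
Proof.
apply/limg_fixedE; rewrite limg_span; apply/span_subvP => w.
by rewrite !inE => /or3P[]/eqP->; do ?apply: orbit_plane_f; exact: orbit_plane_id.
Qed.

Lemma limg_sub U : (f @: U)%VS = U -> forall v, v \in U -> f v \in U.
Proof. by move=> E v vU; rewrite -E memv_img. Qed.

Lemma orbit_plane_fixed v U : (f @: U)%VS = U -> v \in U -> (orbit_plane v <= U)%VS.
Proof.
move=> E vU; have fU := limg_sub E; apply/span_subvP => w.
by rewrite !inE => /or3P[]/eqP->; rewrite ?fU ?fU.
Qed.

Lemma orbit_line_fixed v U : (f @: U)%VS = U -> v \in U -> (orbit_line v <= U)%VS.
Proof.
move=> E vU; have fU := limg_sub E; apply/span_subvP => w.
by rewrite !inE => /orP[]/eqP->; rewrite ?fU.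
Qed.

Lemma dim_orbit_line w v : quadratic w v -> \dim (orbit_line v) = 2%N.
Proof. by move=> /andP[/eqP]. Qed.

Lemma quadratic_neq0 w v : quadratic w v -> v != 0.
Proof.
move=> /andP[/free2P fr _]; apply/eqP => v0.
have [|/eqP] := fr 1 0; last by rewrite oner_eq0.
by rewrite v0 scaler0 scale0r addr0.
Qed.

Lemma quadraticZ w v (c : F) : c != 0 -> quadratic w v -> quadratic w (c *: v).
Proof.
move=> c0 /andP[/free2P fr /eqP E]; apply/andP; split.
  apply/free2P => x y; rewrite (linearZ_LR f) (scalerA x) (scalerA y).
  move=> /fr[/eqP + /eqP].
  by rewrite !mulf_eq0 (negPf c0) !orbF => /eqP -> /eqP ->.
by rewrite !linearZ /= E scalerN scalerDr !scalerA; apply/eqP; congr (- (_ *: _ + _ *: _));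
  rewrite mulrC.
Qed.

Lemma quadratic_eigen w x v : quadratic w v -> f v = x *: v -> False.
Proof.
move=> /andP[/free2P fr _] E; have [|_ /eqP] := fr (- x) 1.
  by rewrite E scale1r scaleNr addNr.
by rewrite oner_eq0.
Qed.

Lemma quadratic_inj w w' v : quadratic w v -> quadratic w' v -> w = w'.
Proof.
move=> /andP[/free2P fr /eqP E] /andP[_ /eqP E'].
have [|_ /eqP] := fr (w' ^+ 2 - w ^+ 2) (w' - w); last first.
  by rewrite subr_eq0 => /eqP.
rewrite !scalerBl addrACA addrC -!opprD addrC [X in X - _]addrC.
by rewrite -[X in _ - X]opprK [X in _ - - - X]addrC -E opprK -[X in X + _]opprK -E' addNr.
Qed.

Lemma quadratic_notcyclic w v : quadratic w v -> ~~ cyclic3 v.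
Proof.
move=> /andP[_ /eqP E]; apply/negP => /cyclic3P fr.
have [|_ _ /eqP] := fr (w ^+ 2) w 1; last by rewrite oner_eq0.
by rewrite /cact scale1r E [X in X - _]addrC subrr.
Qed.

Lemma cact_quadE w v :
  (cact (w ^+ 2) w 1 v == 0) = (f (f v) == - (w *: f v + w ^+ 2 *: v)).
Proof. by rewrite /cact scale1r addrC addr_eq0 [w *: f v + _]addrC. Qed.

(** The operator f^2 + w f + w^2 commutes with f, so it kills the whole orbit line once it kills
    u. *)
Lemma quadratic_line w u v : quadratic w u -> free [:: v; f v] ->
  v \in orbit_line u -> quadratic w v.
Proof.
move=> /andP[_ qu] fv /mem_span2[x [y vE]]; rewrite /quadratic fv -cact_quadE.
move: qu; rewrite -cact_quadE => /eqP qu.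
have -> : v = cact x y 0 u by rewrite /cact scale0r addr0.
have -> : cact (w ^+ 2) w 1 (cact x y 0 u) = cact x y 0 (cact (w ^+ 2) w 1 u).
  by rewrite !cact_cact //; congr cact; ring.
by rewrite qu /cact !linear0 !addr0 eqxx.
Qed.

Lemma eigen_notcyclic x v : f v = x *: v -> ~~ cyclic3 v.
Proof.
move=> E; apply/negP => /cyclic3P fr.
have [|_ /eqP] := fr (- x) 1 0; last by rewrite oner_eq0.
by rewrite /cact E scale1r scale0r addr0 scaleNr addNr.
Qed.

Lemma eigen_root x v : v != 0 -> f v = x *: v -> x ^+ 3 = 1.
Proof.
move=> v0 E; have [[w w3 E']|[w _ qv]|c] := cyclic_trichotomy f3 v0.
- suff -> : x = w by [].
  apply/eqP; rewrite -subr_eq0 -(inj_eq (_ : injective (fun k => k *: v))).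
    by rewrite scalerBl -E -E' subrr scale0r.
  move=> k l /eqP; rewrite -subr_eq0 -scalerBl scaler_eq0 (negPf v0) orbF subr_eq0.
  by move/eqP.
- by case: (quadratic_eigen qv E).
- by rewrite (negPf (eigen_notcyclic E)) in c.
Qed.

Section Plane.

Variable v0 : vT.
Hypothesis c0 : cyclic3 v0.

(** The polynomial (T^3 - 1) / (T - w) applied to v0: for w^3 = 1 it spans the kernel of f - w in
    the plane. *)
Definition eigenpt w := cact (w ^+ 2) w 1 v0.

(** The vector (f - w) v0, which together with its image under f spans the fixed line labelled w. *)
Definition minor w := cact (- w) 1 0 v0.

(* The points f m - w t m and m (for t = oo) of the line spanned by m = (f - w) v0
   and f m; such a point is fixed exactly when t^2 + t + 1 = 0. *)
Definition quadpt w o :=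
  if o is Some t then cact (w ^+ 2 * t) (- w - w * t) 1 v0 else minor w.

Definition valid_param o := if o is Some t then t ^+ 2 + t + 1 != 0 else true.

Lemma root3_neq0 w : w ^+ 3 = 1 -> w != 0.
Proof.
by apply: contra_eq_neq => ->; rewrite expr0n eq_sym oner_eq0.
Qed.

Lemma cact_eq0 x y z : cact x y z v0 = 0 -> [/\ x = 0, y = 0 & z = 0].
Proof. by move: x y z; apply/cyclic3P. Qed.

Lemma minor_neq0 w : minor w != 0.
Proof. by apply/eqP => /cact_eq0[_ /eqP]; rewrite oner_eq0. Qed.

Lemma f_eigenpt w : w ^+ 3 = 1 -> f (eigenpt w) = w *: eigenpt w.
Proof. by move=> w3; rewrite /eigenpt f_cact // cactZ; congr cact; ring: w3. Qed.

Lemma eigenpt_neq0 w : eigenpt w != 0.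
Proof. by apply/eqP => /cact_eq0[_ _ /eqP]; rewrite oner_eq0. Qed.

Lemma eigen_in_plane w v : v \in orbit_plane v0 -> f v = w *: v ->
  exists c, v = c *: eigenpt w.
Proof.
move=> /mem_orbit_plane[x [y [z ->]]]; rewrite f_cact // cactZ => /(cact_inj c0)[E1 E2 E3].
by exists z; rewrite /eigenpt cactZ E2 E3; congr cact; ring.
Qed.

Lemma quadratic_quadpt w o : w ^+ 3 = 1 -> valid_param o -> quadratic w (quadpt w o).
Proof.
move=> w3 vo; have w0 := root3_neq0 w3.
(* Multiplied by w, the first condition says a + b w + c w^2 = 0: then a + b T + c T^2 is divisible
   by T - w and hence killed by T^2 + w T + w^2. The second condition is the independence of the
   vector and its image. *)
have quad a b c : b + w * c + w ^+ 2 * a = 0 ->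
    (forall x y, x * a + y * c = 0 -> x * b + y * a = 0 -> x * c + y * b = 0 ->
       x = 0 /\ y = 0) -> quadratic w (cact a b c v0).
  move=> E ind; apply/andP; split.
    apply/free2P => x y; rewrite f_cact // !cactZ cactD => /cact_eq0[].
    exact: ind.
  rewrite !f_cact // !cactZ cactD cactN; apply/eqP; congr cact.
  - by apply/eqP; rewrite -subr_eq0; apply/eqP; rewrite -[RHS]E; ring.
  - apply/eqP; rewrite -subr_eq0; apply/eqP.
    by rewrite -(mulr0 (w ^+ 2)) -[in RHS]E; ring: w3.
  - apply/eqP; rewrite -subr_eq0; apply/eqP.
    by rewrite -(mulr0 w) -[in RHS]E; ring: w3.
case: o vo => [t|_] /=.
  move=> t0; apply: quad; first by ring: w3.
  move=> x y E1 _ E3.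
  (* Eliminating x leaves y (t^2 + t + 1) = 0; here the validity of the parameter enters. *)
  have y0 : y = 0.
    apply: (mulIf t0); rewrite mul0r -[RHS]E1 -[RHS]subr0.
    by rewrite -[X in _ - X](mulr0 (w ^+ 2 * t)) -E3; ring: w3.
  by split=> //; move: E3; rewrite y0 mul0r addr0 mulr1.
apply: quad; first by ring: w3.
move=> x y E1 E2 _.
have x0 : x = 0.
  by apply: (mulIf (_ : - w != 0)); rewrite ?oppr_eq0 // mul0r -[RHS]E1; ring.
by split=> //; move: E2; rewrite x0 mul0r add0r => /eqP;
  rewrite mulf_eq0 oppr_eq0 (negPf w0) orbF => /eqP.
Qed.

Lemma quadpt_mem w o : quadpt w o \in orbit_plane v0.
Proof. by case: o => [t|]; exact: cact_mem. Qed.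

Lemma quadptP w v : w ^+ 3 = 1 -> v \in orbit_plane v0 -> quadratic w v ->
  exists2 o, valid_param o & exists2 c, c != 0 & v = c *: quadpt w o.
Proof.
move=> w3 /mem_orbit_plane[x [y [z ->]]] qv; have w0 := root3_neq0 w3.
have v0n := quadratic_neq0 qv.
have yE : y = - w * z - w ^+ 2 * x.
  move: (qv) => /andP[_ /eqP]; rewrite !f_cact // !cactZ cactD cactN.
  by move=> /(cact_inj c0)[-> _ _]; ring.
have [z0|z0] := eqVneq z 0.
  exists None => //; exists (- (w ^+ 2 * x)).
    rewrite oppr_eq0 mulf_eq0 expf_eq0 /= (negPf w0) /=.
    apply: contraNneq v0n => x0.
    by rewrite yE z0 x0 !mulr0 subr0 /cact !scale0r !addr0.
  by rewrite /= /minor cactZ yE z0; congr cact; ring: w3.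
have zx : z * (x / z) = x by rewrite mulrCA divff // mulr1.
(* The coefficient of v0 in [quadpt w (Some t)] is w^2 t; scaled by z it must be x, so t = w x / z
   as w^3 = 1. *)
have E : cact x y z v0 = z *: quadpt w (Some (w * (x / z))).
  rewrite /= cactZ yE; congr cact; last by rewrite mulr1.
    rewrite (_ : z * _ = w ^+ 3 * (z * (x / z))); last by ring.
    by rewrite w3 mul1r zx.
  rewrite (_ : z * _ = - w * z - w ^+ 2 * (z * (x / z))); last by ring.
  by rewrite zx.
exists (Some (w * (x / z))); last by exists z.
(* A root t of t^2 + t + 1 would make the vector an eigenvector for - w - w t. *)
rewrite E in qv => /=; set t := w * _ in qv *; apply/eqP => t0.
have := quadraticZ (_ : z^-1 != 0) qv; rewrite invr_eq0 scalerA mulVf // scale1r.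
move=> /(_ z0) qu; apply: (@quadratic_eigen w (- w - w * t) _ qu).
rewrite /= f_cact // cactZ; congr cact.
- by rewrite -[LHS]addr0 -(oppr0 F) -t0; ring: w3.
- by rewrite -[LHS]addr0 -(mulr0 (w ^+ 2)) -t0; ring: w3.
- by rewrite mulr1.
Qed.

Lemma quadpt_inj w w' o o' c : w ^+ 3 = 1 -> w' ^+ 3 = 1 ->
    valid_param o -> valid_param o' -> c != 0 ->
  quadpt w o = c *: quadpt w' o' -> w = w' /\ o = o'.
Proof.
move=> w3 w3' vo vo' cn0 E.
have ww : w = w'.
  apply: (@quadratic_inj w w' (quadpt w o)); first exact: quadratic_quadpt.
  by rewrite E; apply/quadraticZ/quadratic_quadpt.
split=> //; move: E; rewrite -ww; have w0 := root3_neq0 w3.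
case: o vo => [t|] vo; case: o' vo' => [t'|] vo' //=; rewrite cactZ => /(cact_inj c0)[].
- move=> E1 _; rewrite mulr1 => c1; congr Some.
  by apply: (mulfI (expf_neq0 2 w0)); rewrite E1 -c1 mul1r.
- by move=> _ _ /eqP; rewrite mulr0 oner_eq0.
- by move=> _ _ /eqP; rewrite mulr1 eq_sym (negPf cn0).
Qed.

(** All vectors labelled w lie on one line, since [quadptP] writes each as a combination of
    [minor w] and its image. *)
Lemma orbit_line_minor w v : w ^+ 3 = 1 -> v \in orbit_plane v0 -> quadratic w v ->
  orbit_line v = orbit_line (minor w).
Proof.
move=> w3 vP qv; apply/eqP; rewrite eqEdim (dim_orbit_line qv).
have qm := quadratic_quadpt (o := None) w3 isT.
rewrite (dim_orbit_line qm) andbT.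
have flm u : u \in orbit_line (minor w) -> f u \in orbit_line (minor w).
  move=> /mem_span2[x [y ->]]; rewrite linearD !linearZ /=.
  rewrite memvD ?memvZ ?orbit_line_f //.
  have /andP[_ /eqP /= ->] := qm.
  by rewrite memvN memvD ?memvZ ?orbit_line_f ?orbit_line_id.
have vl : v \in orbit_line (minor w).
  have [o _ [c _ ->]] := quadptP w3 vP qv; apply: memvZ.
  case: o => [t|]; last exact: orbit_line_id.
  apply/mem_span2; exists (- (w * t)), 1; rewrite /= /minor f_cact // !cactZ cactD.
  by congr cact; ring.
by apply/span_subvP => u; rewrite !inE => /orP[]/eqP->; rewrite ?flm.
Qed.

End Plane.

End CyclicPlane.

(** * Counting in the fixed planes, through an abstract matrix model [H] *)

Section FixedPlanes.

Variables (F : finFieldType) (L : fieldExtType F).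
Variable S : {vspace 'rV[L]_3} -> Prop.
Variable phi : {vspace 'rV[L]_3} -> {vspace 'rV[L]_3}.
Variable sigma : {vspace bose_space L} -> {vspace bose_space L}.
Variable f : 'End(bose_space L).
Variable H : {linear 'M[F]_3 -> bose_space L}.
Variable G : bose_space L -> 'M[F]_3.

Hypothesis sigmaE : forall U, sigma U = (f @: U)%VS.
Hypothesis HK : cancel H G.
Hypothesis GK : cancel G H.
Hypothesis fH : forall X, f (H X) = H (shift F *m X).
Hypothesis type_IE : forall A,
  type_point S A <-> exists2 X, \rank X = 1%N & A = <[H X]>%VS.
Hypothesis type_IIE : forall A,
  type_point (typeII phi) A <-> exists2 X, \rank X = 2%N & A = <[H X]>%VS.

Variables (q g : nat) (n : int).
Hypothesis card_F : #|F| = q.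
Hypothesis n_lt_q : (n < q%:Z)%R.
Hypothesis card_roots : #|[set w : F | w ^+ 3 == 1]| = g.
Hypothesis card_quad : #|[set t : F | t ^+ 2 + t + 1 == 0]|%:Z = 1 + n.

Local Notation W := (bose_space L).
Local Notation cact := (cact f).
Local Notation cyclic3 := (cyclic3 f).
Local Notation quadratic := (quadratic f).
Local Notation roots3 := [set w : F | w ^+ 3 == 1].
Implicit Types (v u : W) (A l pi : {vspace W}) (w x y z t : F).

Definition rk v := \rank (G v).

Lemma f3 v : f (f (f v)) = v.
Proof. by rewrite -(GK v) !fH shift3. Qed.

Lemma cact_H x y z X : cact x y z (H X) = H (circ x y z X).
Proof. by rewrite /cact /circ !fH !linearD !linearZ. Qed.

Lemma rk_H X : rk (H X) = \rank X.
Proof. by rewrite /rk HK. Qed.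

Lemma rk_cact x y z v : (rk (cact x y z v) <= rk v)%N.
Proof. by rewrite -(GK v) cact_H !rk_H mxrankS // circ_sub. Qed.

Lemma rk_eq0 v : (rk v == 0%N) = (v == 0).
Proof. by rewrite mxrank_eq0 -(can_eq HK) GK linear0. Qed.

Lemma rk_line u v : u \in orbit_line f v -> (rk u <= rk v)%N.
Proof.
move=> /mem_span2[x [y ->]].
by have := rk_cact x y 0 v; rewrite /cact scale0r addr0.
Qed.

Lemma cyclic3_H X : reflect (mcyclic X) (cyclic3 (H X)).
Proof.
apply: (iffP (cyclic3P _ _)) => c x y z.
  by move=> E; apply: c; rewrite cact_H E linear0.
by rewrite cact_H -(linear0 H) => /(can_inj HK)/c.
Qed.

Lemma rk_eigen w v : f v = w *: v -> (rk v <= 1)%N.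
Proof.
rewrite -(GK v) fH -linearZ => /(can_inj HK) E.
by rewrite rk_H (rank_eigen E).
Qed.

Lemma sigma_line v : sigma <[v]>%VS = <[f v]>%VS.
Proof. by rewrite sigmaE limg_line. Qed.

Lemma typeI_rk A : type_point S A <-> exists2 v, rk v = 1%N & A = <[v]>%VS.
Proof.
rewrite type_IE; split=> [[X rX ->]|[v rv ->]]; first by exists (H X); rewrite ?rk_H.
by exists (G v); rewrite ?GK.
Qed.

Lemma typeII_rk A : type_point (typeII phi) A <-> exists2 v, rk v = 2%N & A = <[v]>%VS.
Proof.
rewrite type_IIE; split=> [[X rX ->]|[v rv ->]]; first by exists (H X); rewrite ?rk_H.
by exists (G v); rewrite ?GK.
Qed.

Lemma rk_neq0 v k : rk v = k.+1 -> v != 0.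
Proof. by move=> rv; rewrite -rk_eq0 rv. Qed.

Lemma collinear_notcyclic v :
  collinear <[v]>%VS (sigma <[v]>%VS) (sigma (sigma <[v]>%VS)) -> ~~ cyclic3 v.
Proof.
rewrite !sigma_line => -[l dl]; rewrite -!memvE => -[v1 v2 v3].
apply/negP => /dim_orbit_plane d3.
have : (orbit_plane f v <= l)%VS.
  by apply/span_subvP => u; rewrite !inE => /or3P[]/eqP->.
by move/dimvS; rewrite d3 dl.
Qed.

Lemma quadratic_collinear w v : quadratic w v ->
  collinear <[v]>%VS (sigma <[v]>%VS) (sigma (sigma <[v]>%VS)).
Proof.
move=> qv; exists (orbit_line f v); first exact: dim_orbit_line qv.
rewrite !sigma_line -!memvE orbit_line_id orbit_line_f; split=> //.
have /andP[_ /eqP->] := qv.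
by rewrite memvN memvD ?memvZ ?orbit_line_id ?orbit_line_f.
Qed.

Lemma quadratic_distinct w v : quadratic w v ->
  distinct3 <[v]>%VS (sigma <[v]>%VS) (sigma (sigma <[v]>%VS)).
Proof.
move=> qv; have vn0 := quadratic_neq0 qv.
have dv : <[v]>%VS <> <[f v]>%VS.
  move=> /esym/eqP/eq_vlineP => /(_ vn0)[c _ /(quadratic_eigen qv)]; exact.
have fl u u' : <[u]>%VS = <[u']>%VS -> <[f u]>%VS = <[f u']>%VS.
  by move=> E; rewrite -!sigma_line E.
rewrite !sigma_line; split=> // E.
  by apply: dv; have := fl _ _ E; rewrite f3 => ->.
by apply: dv; have := fl _ _ (fl _ _ E); rewrite !f3.
Qed.

Lemma fixed_pointP A : fixed_point sigma A <->
  exists v w, [/\ v != 0, w ^+ 3 = 1, f v = w *: v & A = <[v]>%VS].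
Proof.
split=> [[/dim1_vline[v v0 ->]]|[v [w [v0 w3 E ->]]]].
  rewrite sigma_line => /eqP/eq_vlineP => /(_ v0)[w _ E].
  by exists v, w; split=> //; apply: eigen_root f3 _ _ v0 E.
split; first exact: dim_vline1.
rewrite sigma_line; apply/eqP/eq_vlineP => //; exists w => //.
exact: root3_neq0.
Qed.

(** In the trichotomy, an eigenvector contradicts distinctness and a cyclic vector contradicts
    collinearity. *)
Lemma I_collinearP A : I_collinear_point S sigma A <->
  exists v w, [/\ w ^+ 3 = 1, quadratic w v, rk v = 1%N & A = <[v]>%VS].
Proof.
split=> [[/typeI_rk[v rv ->] [d _ _] c]|[v [w [w3 qv rv ->]]]].
  have [[w w3 E]|[w w3 qv]|cv] := cyclic_trichotomy f3 (rk_neq0 rv).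
  - case: d; rewrite sigma_line; apply/esym/eqP/eq_vlineP; first exact: rk_neq0 rv.
    by exists w => //; exact: root3_neq0.
  - by exists v, w.
  - by have := collinear_notcyclic c; rewrite cv.
split; first by apply/typeI_rk; exists v.
  exact: quadratic_distinct qv.
exact: quadratic_collinear qv.
Qed.

(** Here eigenvectors are excluded by rank: theirs is at most 1 by [rk_eigen]. *)
Lemma II_collinearP A : II_collinear_point phi sigma A <->
  exists v w, [/\ w ^+ 3 = 1, quadratic w v, rk v = 2%N & A = <[v]>%VS].
Proof.
split=> [[/typeII_rk[v rv ->] c]|[v [w [w3 qv rv ->]]]].
  have [[w w3 /rk_eigen]|[w w3 qv]|cv] := cyclic_trichotomy f3 (rk_neq0 rv).
  - by rewrite rv.
  - by exists v, w.
  - by have := collinear_notcyclic c; rewrite cv.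
split; first by apply/typeII_rk; exists v.
exact: quadratic_collinear qv.
Qed.

Lemma II_triangleP A : II_triangle_point phi sigma A <->
  exists v, [/\ cyclic3 v, rk v = 2%N & A = <[v]>%VS].
Proof.
split=> [[/typeII_rk[v rv ->] c]|[v [cv rv ->]]].
  have [[w w3 /rk_eigen]|[w w3 qv]|cv] := cyclic_trichotomy f3 (rk_neq0 rv).
  - by rewrite rv.
  - by case: c; exact: quadratic_collinear qv.
  - by exists v.
split; first by apply/typeII_rk; exists v.
by move/collinear_notcyclic; rewrite cv.
Qed.

(** The orbit of a triangle point already spans three dimensions inside the fixed plane. *)
Lemma fixed_II_planeP pi : fixed_II_plane phi sigma pi <->
  exists v, [/\ cyclic3 v, rk v = 2%N & pi = orbit_plane f v].
Proof.
split=> [[d3 E [A /II_triangleP[v [cv rv ->]] vpi]]|[v [cv rv ->]]].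
  exists v; split=> //; apply/esym/eqP.
  rewrite eqEdim dim_orbit_plane // d3 leqnn andbT.
  by apply: orbit_plane_fixed; rewrite -?sigmaE // memvE.
split; first exact: dim_orbit_plane.
  by rewrite sigmaE limg_orbit_plane //; exact: f3.
exists <[v]>%VS; first by apply/II_triangleP; exists v.
by rewrite -memvE orbit_plane_id.
Qed.

Lemma rk_minor_H X w : rk (minor f (H X) w) = \rank (mshift w X).
Proof.
rewrite /minor cact_H rk_H /circ /mshift scale1r scale0r addr0.
by rewrite addrC scaleNr.
Qed.

Section OnePlane.

Variable v0 : W.
Hypotheses (c0 : cyclic3 v0) (r0 : rk v0 = 2%N).

Local Notation pi := (orbit_plane f v0).
Local Notation minor := (minor f v0).
Local Notation quadpt := (quadpt f v0).

Lemma rk_plane v : v \in pi -> (rk v <= 2)%N.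
Proof.
by move=> /mem_orbit_plane[x [y [z ->]]]; apply: leq_trans (rk_cact x y z v0) _; rewrite r0.
Qed.

(** A cyclic v generates the whole plane, so v0 is in turn obtained from v by a circulant, which
    cannot raise the rank. *)
Lemma rk_cyclic v : v \in pi -> cyclic3 v -> rk v = 2%N.
Proof.
move=> vp cv; apply/eqP; rewrite eqn_leq rk_plane //.
have : v0 \in orbit_plane f v by rewrite (orbit_plane_eq f3 cv c0 vp) orbit_plane_id.
move=> /mem_orbit_plane[x [y [z E]]].
by have := rk_cact x y z v; rewrite -E r0.
Qed.

(** The labels of those fixed lines of the plane whose non-fixed points are of Type I; whether there
    is one or none decides the type of the plane. *)
Definition roots_I := [set w in roots3 | rk (minor w) == 1%N].

Lemma card_roots_I : (#|roots_I| <= 1)%N.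
Proof.
apply/card_le1_eqP => w w'; rewrite !inE => /andP[_ /eqP r] /andP[_ /eqP r'].
apply/eqP; apply: contra_eqT r0 => ww'.
suff : (rk v0 <= 1)%N by case: (rk v0) => [|[]].
have mE x : rk (minor x) = \rank (mshift x (G v0)) by rewrite -rk_minor_H GK.
apply: (@two_rank1_shifts _ w w'); rewrite -?mE ?r ?r' //; last by rewrite eq_sym.
by apply/cyclic3_H; rewrite GK.
Qed.

Lemma rk_quadratic w v : w ^+ 3 = 1 -> v \in pi -> quadratic w v ->
  rk v = rk (minor w).
Proof.
move=> w3 vp qv; have E := orbit_line_minor f3 c0 w3 vp qv.
apply/eqP; rewrite eqn_leq; apply/andP; split; apply: rk_line.
  by rewrite -E orbit_line_id.
by rewrite E orbit_line_id.
Qed.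

Lemma rk_minor w : w ^+ 3 = 1 -> rk (minor w) = if w \in roots_I then 1%N else 2%N.
Proof.
move=> w3; rewrite !inE w3 eqxx /=; case: eqP => // /eqP r1.
have : (rk (minor w) <= 2)%N by rewrite rk_plane // cact_mem.
have : rk (minor w) != 0%N.
  by rewrite rk_eq0 minor_neq0.
by case: (rk _) r1 => [|[|[|]]].
Qed.

Definition quadratic_points (R : {set F}) A :=
  exists v w, [/\ w \in R, v \in pi, quadratic w v & A = <[v]>%VS].

(** A line has q + 1 points, indexed by F and [None]; the 1 + n roots of t^2 + t + 1 index the fixed
    ones. *)
Lemma card_valid : #|[set o | @valid_param F o]|%:Z = q%:Z - n.
Proof.
have -> : [set o | @valid_param F o] =
    None |: Some @: ~: [set t : F | t ^+ 2 + t + 1 == 0].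
  apply/setP => -[t|]; rewrite !inE //=.
  by rewrite (mem_imset _ _ (@Some_inj _)) !inE.
have nn : None \notin Some @: ~: [set t : F | t ^+ 2 + t + 1 == 0].
  by apply/imsetP => -[].
rewrite cardsU1 nn card_imset; last exact: Some_inj.
have := cardsC [set t : F | t ^+ 2 + t + 1 == 0]; rewrite card_F.
move: card_quad; lia.
Qed.

Lemma total_quadratic_points (R : {set F}) : R \subset roots3 ->
  total_number (quadratic_points R) (#|R|%:Z * (q%:Z - n)).
Proof.
move=> sR; rewrite -card_valid -PoszM -cardsX.
have R3 w : w \in R -> w ^+ 3 = 1 by move/(subsetP sR); rewrite inE => /eqP.
apply: (@total_number_inj _ _ _ (fun wo => <[quadpt wo.1 wo.2]>%VS)).
  move=> [w o] [w' o']; rewrite !inE /= => /andP[/R3 w3 vo] /andP[/R3 w3' vo'] /eqP.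
  have nz : quadpt w' o' != 0.
    by apply: (@quadratic_neq0 _ _ f w'); apply: quadratic_quadpt => //; exact: f3.
  case/(eq_vlineP _ nz) => c cn0.
  by case/(quadpt_inj f3 c0 w3 w3' vo vo' cn0) => -> ->.
move=> A; split=> [[v [w [wR vp qv ->]]]|[[w o]]].
  have [o vo [c cn0 vE]] := quadptP f3 c0 (R3 _ wR) vp qv.
  exists (w, o); rewrite ?inE /= ?wR // vE; apply/eqP/eq_vlineP; last by exists c.
  apply: (@quadratic_neq0 _ _ f w); apply: quadratic_quadpt => //; first exact: f3.
  exact: R3.
rewrite !inE /= => /andP[wR vo] ->; exists (quadpt w o), w; split=> //.
  exact: quadpt_mem.
by apply: quadratic_quadpt => //; [exact: f3|exact: R3].
Qed.

Lemma eq_rk_quadratic (R : {set F}) k A : R \subset roots3 ->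
    (forall w, w ^+ 3 = 1 -> (rk (minor w) == k) = (w \in R)) ->
  (exists v w, [/\ w ^+ 3 = 1, quadratic w v, rk v = k & A = <[v]>%VS]) /\ (A <= pi)%VS
  <-> quadratic_points R A.
Proof.
move=> sR Rk; split=> [[[v [w [w3 qv rv ->]]]]|[v [w [wR vp qv ->]]]].
  rewrite -memvE => vp; exists v, w; split=> //.
  by rewrite -Rk // -(rk_quadratic w3 vp qv) rv.
have w3 : w ^+ 3 = 1 by move/(subsetP sR): wR; rewrite inE => /eqP.
rewrite -memvE; split=> //; exists v, w; split=> //.
by rewrite (rk_quadratic w3 vp qv); apply/eqP; rewrite Rk.
Qed.

Lemma roots_I_sub : roots_I \subset roots3.
Proof. by apply/subsetP => w; rewrite !inE => /andP[]. Qed.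

Lemma roots_I_rk w : w ^+ 3 = 1 -> (rk (minor w) == 1%N) = (w \in roots_I).
Proof. by move=> w3; rewrite rk_minor //; case: ifP. Qed.

Lemma roots_II_rk w : w ^+ 3 = 1 ->
  (rk (minor w) == 2%N) = (w \in roots3 :\: roots_I).
Proof. by move=> w3; rewrite inE rk_minor // [in RHS]inE w3 eqxx andbT; case: ifP. Qed.

Lemma card_roots_II : #|roots3 :\: roots_I|%:Z = g%:Z - #|roots_I|%:Z.
Proof.
have := cardsID roots_I roots3; rewrite card_roots (setIidPr roots_I_sub).
lia.
Qed.

Lemma count_I_collinear :
  contains_exactly pi (#|roots_I|%:Z * (q%:Z - n)) (I_collinear_point S sigma).
Proof.
apply: eq_total_number (total_quadratic_points roots_I_sub) => A.
by rewrite I_collinearP (eq_rk_quadratic _ roots_I_sub roots_I_rk).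
Qed.

Lemma count_II_collinear :
  contains_exactly pi ((g%:Z - #|roots_I|%:Z) * (q%:Z - n))
    (II_collinear_point phi sigma).
Proof.
rewrite -card_roots_II.
have sR : roots3 :\: roots_I \subset roots3 by apply: subsetDl.
apply: eq_total_number (total_quadratic_points sR) => A.
by rewrite II_collinearP (eq_rk_quadratic _ sR roots_II_rk).
Qed.

Lemma count_fixed : contains_exactly pi g (fixed_point sigma).
Proof.
rewrite -card_roots; apply: (@total_number_inj _ _ _ (fun w => <[eigenpt f v0 w]>%VS)).
  move=> w w'; rewrite !inE => /eqP w3 /eqP w3' /eqP.
  have nz := eigenpt_neq0 c0.
  case/(eq_vlineP _ (nz w')) => c cn0 /esym E.
  have := f_eigenpt f3 v0 w3; rewrite -E linearZ /= f_eigenpt //; last exact: f3.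
  rewrite !scalerA => /eqP; rewrite -subr_eq0 -scalerBl scaler_eq0 (negPf (nz w')) orbF.
  by rewrite mulrC -mulrBl mulf_eq0 (negPf cn0) orbF subr_eq0 => /eqP->.
move=> A; rewrite fixed_pointP; split=> [[[v [w [vn0 w3 E ->]]]]|[w]].
  rewrite -memvE => vp; exists w; first by rewrite inE w3.
  have [c vE] := eigen_in_plane f3 c0 vp E.
  apply/eqP/eq_vlineP; first exact: eigenpt_neq0.
  exists c => //; apply: contraNneq vn0 => cE.
  by rewrite vE cE scale0r.
rewrite inE => /eqP w3 ->; rewrite -memvE cact_mem; split=> //.
exists (eigenpt f v0 w), w; split=> //; first exact: eigenpt_neq0.
exact: (f_eigenpt f3 v0 w3).
Qed.

Lemma total_points : total_number (fun A => \dim A = 1%N /\ (A <= pi)%VS)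
  (q%:Z ^+ 2 + q%:Z + 1).
Proof.
have q1 : (1 < q)%N by rewrite -card_F; exact: finNzRing_gt1.
have -> : q%:Z ^+ 2 + q%:Z + 1 = (q ^ 2 + q + 1)%N%:Z by rewrite !PoszD.
pose h (t : F * F * F) := <[cact t.1.1 t.1.2 t.2 v0]>%VS.
have hn0 (t : F * F * F) : t != (0, 0, 0) -> cact t.1.1 t.1.2 t.2 v0 != 0.
  case: t => -[x y] z /=; apply: contraNneq.
  by move/(cact_eq0 c0) => [-> -> ->].
apply: (@total_number_fibres _ _ [set~ (0, 0, 0)] h _ _ q.-1).
- by rewrite -ltnS prednK // (leq_trans _ q1).
- move=> [[x y] z]; rewrite !inE => tn0.
  have -> : [set t in [set~ (0, 0, 0)] | h t == h (x, y, z)] =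
      [set (c * x, c * y, c * z) | c in [set~ 0]].
    apply/setP => -[[x' y'] z']; rewrite !inE.
    apply/andP/imsetP => [[_ /eq_vlineP]|[c]].
      move=> /(_ (hn0 _ tn0))[c cn0] /=; rewrite cactZ // => /(cact_inj c0)[-> -> ->].
      by exists c; rewrite ?inE.
    rewrite !inE => cn0 [-> -> ->]; split.
      apply: contraNneq tn0 => -[/eqP + /eqP + /eqP].
      by rewrite !mulf_eq0 (negPf cn0) /= => /eqP-> /eqP-> /eqP->.
    by apply/eq_vlineP; rewrite ?hn0 //; exists c; rewrite //= cactZ.
  rewrite card_in_imset ?cardsC1 ?card_F // => c d _ _ [] E1 E2 E3.
  have [x0|x0] := eqVneq x 0; last exact: (mulIf x0).
  have [y0|y0] := eqVneq y 0; last exact: (mulIf y0).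
  have [z0|z0] := eqVneq z 0; last exact: (mulIf z0).
  by rewrite x0 y0 z0 eqxx in tn0.
- move=> A; split=> [[/dim1_vline[v vn0 ->]]|[t]].
    rewrite -memvE => /mem_orbit_plane[x [y [z vE]]].
    exists (x, y, z); last by rewrite vE.
    rewrite !inE; apply: contraNneq vn0 => -[xE yE zE].
    by rewrite vE xE yE zE /cact !scale0r !addr0.
  rewrite !inE => tn0 ->; rewrite dim_vline1 ?hn0 //; split=> //.
  by rewrite -memvE cact_mem.
rewrite cardsC1 !card_prod card_F.
case: q q1 => // k _ /=; lia.
Qed.

(** Triangle points are the complement: of the q^2 + q + 1 points, g are fixed and g (q - n) lie on
    the fixed lines without being fixed. The others are cyclic, and [rk_cyclic] gives them rank
    2. *)
Lemma count_II_triangle :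
  contains_exactly pi (q%:Z ^+ 2 + q%:Z + 1 - g%:Z * (q%:Z - n + 1))
    (II_triangle_point phi sigma).
Proof.
have -> : q%:Z ^+ 2 + q%:Z + 1 - g%:Z * (q%:Z - n + 1) =
    q%:Z ^+ 2 + q%:Z + 1 - (g%:Z + #|roots3|%:Z * (q%:Z - n)).
  by rewrite card_roots; ring.
have fQ : total_number (fun A => (fixed_point sigma A /\ (A <= pi)%VS) \/
    quadratic_points roots3 A) (g%:Z + #|roots3|%:Z * (q%:Z - n)).
  apply: (@total_numberU _ _ (quadratic_points roots3) _ _ _ _ _ count_fixed) => //.
    move=> A [/fixed_pointP[v [w [vn0 w3 E ->]]] _] [u [w' [_ _ qu /eqP]]].
    case/(eq_vlineP _ (quadratic_neq0 qu)) => c cn0 vE.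
    move: E; rewrite vE => E; apply: (quadratic_eigen (quadraticZ cn0 qu) E).
  exact: total_quadratic_points.
apply: total_numberD total_points fQ => A.
  move=> [[[d1 _] sA]|[v [w [_ vp qv ->]]]] //.
  by rewrite -memvE dim_vline1 // (quadratic_neq0 qv).
split=> [[/II_triangleP[v [cv rv ->]]]|[[/dim1_vline[v vn0 ->] sA] nfQ]].
  move=> vp; rewrite dim_vline1 ?(rk_neq0 rv) //; split=> // -[[/fixed_pointP]|].
    move=> [u [w [un0 w3 E /eqP uv]]] _; case/(eq_vlineP _ un0): uv => c cn0 vE.
    have /eigen_notcyclic : f v = w *: v by rewrite vE linearZ /= E !scalerA mulrC.
    by rewrite cv.
  move=> [u [w [_ _ qu /eqP]]]; case/(eq_vlineP _ (quadratic_neq0 qu)) => c cn0 vE.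
  by have /quadratic_notcyclic := quadraticZ cn0 qu; rewrite -vE cv.
split=> //; apply/II_triangleP; exists v.
rewrite -memvE in sA.
have [[w w3 E]|[w w3 qv]|cv] := cyclic_trichotomy f3 vn0.
- by case: nfQ; left; rewrite -memvE; split=> //; apply/fixed_pointP; exists v, w.
- by case: nfQ; right; exists v, w; split=> //; rewrite inE w3.
- by split=> //; exact: rk_cyclic.
Qed.

(** One count for both kinds of fixed lines, according to the rank k of their non-fixed points. The
    label can be recovered from the line, since a vector satisfies the quadratic relation for only
    one w. *)
Lemma total_orbit_lines (R : {set F}) k X (Y : {vspace W} -> Prop) :
    R \subset roots3 -> (forall w, w ^+ 3 = 1 -> (rk (minor w) == k) = (w \in R)) ->
    (forall A, X A <->
      exists v w, [/\ w ^+ 3 = 1, quadratic w v, rk v = k & A = <[v]>%VS]) ->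
    (forall l, Y l <->
      [/\ \dim l = 2%N, sigma l = l & exists2 A, X A & (A <= l)%VS]) ->
  contains_exactly pi #|R| Y.
Proof.
move=> sR Rk XE YE.
have R3 w : w \in R -> w ^+ 3 = 1 by move/(subsetP sR); rewrite inE => /eqP.
have qm w : w \in R -> quadratic w (minor w).
  by move=> /R3 w3; apply: (@quadratic_quadpt _ _ f f3 v0 c0 w None).
have mp w : minor w \in pi by apply: cact_mem.
apply: (@total_number_inj _ _ _ (fun w => orbit_line f (minor w))).
  move=> w w' wR wR' E.
  have : minor w \in orbit_line f (minor w') by rewrite -E orbit_line_id.
  move=> mm; apply: (@quadratic_inj _ _ f w w' (minor w)); first exact: qm.
  by apply: (quadratic_line f3 (qm _ wR') _ mm); case/andP: (qm _ wR).
move=> l; rewrite YE; split.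
  move=> [[dl El [A /XE[v [w [w3 qv rv ->]]]]]]; rewrite -!memvE => vl lp.
  have vp : v \in pi by apply: subvP lp _ vl.
  exists w; first by rewrite -Rk // -(rk_quadratic w3 vp qv) rv.
  rewrite -(orbit_line_minor f3 c0 w3 vp qv); apply/esym/eqP.
  rewrite eqEdim dl (dim_orbit_line qv) andbT orbit_line_fixed //.
  by rewrite -sigmaE.
move=> [w wR ->]; split; last first.
  apply/span_subvP => u; rewrite !inE => /orP[]/eqP-> //.
  by apply: orbit_plane_f f3 _ _ (mp w).
split; first exact: dim_orbit_line (qm w wR).
  rewrite sigmaE; apply/limg_fixedE; first exact: f3.
  rewrite limg_span; apply/span_subvP => u; rewrite !inE => /orP[]/eqP->.
    exact: orbit_line_f.
  have /andP[_ /eqP->] := qm w wR.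
  by rewrite memvN memvD ?memvZ ?orbit_line_f ?orbit_line_id.
exists <[minor w]>%VS; last by rewrite -memvE orbit_line_id.
apply/XE; exists (minor w), w; split=> //; [exact: R3|exact: qm|].
by apply/eqP; rewrite Rk //; exact: R3.
Qed.

Lemma count_fixed_I_lines : contains_exactly pi #|roots_I| (fixed_I_line S sigma).
Proof.
by apply: total_orbit_lines roots_I_sub roots_I_rk (I_collinearP) _.
Qed.

Lemma count_fixed_II_lines :
  contains_exactly pi (g%:Z - #|roots_I|%:Z) (fixed_II_line phi sigma).
Proof.
rewrite -card_roots_II.
by apply: total_orbit_lines (subsetDl _ _) roots_II_rk (II_collinearP) _.
Qed.

End OnePlane.

(** Circulants commute with C - w, so [minor f v w] is a circulant image of a vector of rank 1, and
    it is nonzero. Hence [roots_I] depends on the plane only and not on its generator. *)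
Lemma roots_I_mem v v' w : cyclic3 v -> cyclic3 v' -> v \in orbit_plane f v' ->
  w \in roots_I v' -> w \in roots_I v.
Proof.
move=> cv cv' /mem_orbit_plane[x [y [z E]]].
rewrite !inE => /andP[/eqP w3 /eqP r1]; rewrite w3 eqxx eqn_leq /=.
have mE : minor f v w = cact x y z (minor f v' w).
  by rewrite /minor E !cact_cact; [congr cact; ring|exact: f3|exact: f3].
by rewrite lt0n rk_eq0 minor_neq0 // andbT mE (leq_trans (rk_cact _ _ _ _)) ?r1.
Qed.

Lemma roots_I_H X w :
  (w \in roots_I (H X)) = (w ^+ 3 == 1) && (\rank (mshift w X) == 1%N).
Proof. by rewrite !inE rk_minor_H. Qed.

Lemma orbit_plane_II1 v : cyclic3 v -> rk v = 2%N -> #|roots_I v| = 1%N ->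
  fixed_II1_plane S phi sigma q n g (orbit_plane f v).
Proof.
move=> cv rv k1.
have cI := count_I_collinear cv rv; have cII := count_II_collinear cv rv.
have lI := count_fixed_I_lines cv rv; have lII := count_fixed_II_lines cv rv.
rewrite k1 mul1r in cI; rewrite k1 in cII lI lII.
split; first by apply/fixed_II_planeP; exists v.
by split; split=> //; [exact: count_fixed|exact: count_II_triangle].
Qed.

Lemma orbit_plane_II2 v : cyclic3 v -> rk v = 2%N -> #|roots_I v| = 0%N ->
  fixed_II2_plane phi sigma q n g (orbit_plane f v).
Proof.
move=> cv rv k0.
have cII := count_II_collinear cv rv; have lII := count_fixed_II_lines cv rv.
rewrite k0 subr0 in cII lII.
split; first by apply/fixed_II_planeP; exists v.
by split=> //; split=> //; [exact: count_fixed|exact: count_II_triangle].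
Qed.

(** The two prescribed numbers (g - 1) (q - n) and g (q - n) differ because n < q. *)
Lemma II1_II2 pi : fixed_II1_plane S phi sigma q n g pi ->
  fixed_II2_plane phi sigma q n g pi -> False.
Proof.
move=> [_ [[_ _ c1 _] _]] [_ [[_ c2 _] _]].
have := total_number_unique c1 c2; move/eqP.
rewrite mulrBl mul1r -subr_eq0 addrAC subrr add0r oppr_eq0 subr_eq0.
by move=> /eqP qn; move: n_lt_q; rewrite qn Order.POrderTheory.ltxx.
Qed.

Lemma card_roots_I_cases v : cyclic3 v -> rk v = 2%N ->
  #|roots_I v| = 0%N \/ #|roots_I v| = 1%N.
Proof.
by move=> cv rv; have := card_roots_I cv rv; case: #|_| => [|[|//]]; [left|right].
Qed.

Lemma fixed_II1_planeP pi : fixed_II1_plane S phi sigma q n g pi <->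
  exists v, [/\ cyclic3 v, rk v = 2%N, #|roots_I v| = 1%N & pi = orbit_plane f v].
Proof.
split=> [II1|[v [cv rv k1 ->]]]; last exact: orbit_plane_II1.
have [/fixed_II_planeP[v [cv rv E]] _] := II1.
exists v; split=> //; have [k0|//] := card_roots_I_cases cv rv.
by case: (II1_II2 II1); rewrite E; exact: orbit_plane_II2.
Qed.

Lemma fixed_II2_planeP pi : fixed_II2_plane phi sigma q n g pi <->
  exists v, [/\ cyclic3 v, rk v = 2%N, #|roots_I v| = 0%N & pi = orbit_plane f v].
Proof.
split=> [II2|[v [cv rv k1 ->]]]; last exact: orbit_plane_II2.
have [/fixed_II_planeP[v [cv rv E]] _] := II2.
exists v; split=> //; have [//|k1] := card_roots_I_cases cv rv.
by case: (II1_II2 _ II2); rewrite E; exact: orbit_plane_II1.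
Qed.

Lemma fixed_II_plane_cases pi : fixed_II_plane phi sigma pi ->
  (fixed_II1_plane S phi sigma q n g pi /\ ~ fixed_II2_plane phi sigma q n g pi) \/
  (~ fixed_II1_plane S phi sigma q n g pi /\ fixed_II2_plane phi sigma q n g pi).
Proof.
move=> /fixed_II_planeP[v [cv rv ->]].
have [k|k] := card_roots_I_cases cv rv; [right|left].
  have II2 := orbit_plane_II2 cv rv k.
  by split=> // II1; apply: II1_II2 II1 II2.
have II1 := orbit_plane_II1 cv rv k.
by split=> // II2; apply: II1_II2 II1 II2.
Qed.

Lemma q_gt1 : (1 < q)%N.
Proof. by rewrite -card_F; exact: finNzRing_gt1. Qed.

Lemma card_indep :
  #|[set ab : 'rV[F]_3 * 'rV[F]_3 | indep ab.1 ab.2]| = ((q ^ 3 - 1) * (q ^ 3 - q))%N.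
Proof.
have cV : #|{: 'rV[F]_3}| = (q ^ 3)%N by rewrite card_mx card_F.
rewrite -sum1_card (eq_bigl (fun ab : 'rV[F]_3 * 'rV[F]_3 => (ab.1 != 0) && indep ab.1 ab.2)).
  rewrite -(pair_big_dep (fun a : 'rV[F]_3 => a != 0) (fun a b => indep a b)
    (fun _ _ => 1%N)) /=.
  rewrite (eq_bigr (fun=> (q ^ 3 - q)%N)) ?sum_nat_const.
    by rewrite cardC1 cV subn1.
  move=> a a0; rewrite sum1_card.
  rewrite -[#|_|]cardsE (_ : [set b in _] = ~: [set c *: a | c in F]).
    rewrite cardsCs setCK cV card_imset ?card_F // => c d /eqP.
    by rewrite -subr_eq0 -scalerBl scaler_eq0 (negPf a0) orbF subr_eq0 => /eqP.
  apply/setP => b; rewrite !inE; apply/idP/negP => [ind /imsetP[c _ bE]|nb].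
    have [|_ /eqP] := elimT (indepP a b) ind c (- 1); last by rewrite oppr_eq0 oner_eq0.
    by rewrite bE scaleN1r subrr.
  apply/indepP => x y E; have y0 : y = 0.
    apply: contraNeq (introN idP nb) => y0; apply/imsetP; exists (- (y^-1 * x)) => //.
    apply: (scalerI y0); rewrite scalerA mulrN mulVKf // scaleNr.
    by apply/eqP; rewrite -addr_eq0 addrC E.
  move: E; rewrite y0 scale0r addr0 => /eqP; rewrite scaler_eq0 (negPf a0) orbF.
  by move/eqP.
move=> ab; rewrite inE; case: (boolP (indep _ _)) => [/indep_neq0[->]//|].
by rewrite andbF.
Qed.

Lemma mk1_sub w (a b : 'rV[F]_3) : (mk1 w a b <= col_mx a b)%MS.
Proof.
have := submx_refl (col_mx a b); rewrite {1}col_mx_sub => /andP[aab bab].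
by apply/mk_subP; split; rewrite ?scalemx_sub ?addmx_sub.
Qed.

Lemma mk2_sub (a b : 'rV[F]_3) : (mk2 a b <= col_mx a b)%MS.
Proof.
have := submx_refl (col_mx a b); rewrite {1}col_mx_sub => /andP[aab bab].
by apply/mk_subP; split; rewrite ?sub0mx.
Qed.

Lemma mem_orbit_plane_H X Y :
  reflect (exists x y z, Y = circ x y z X) (H Y \in orbit_plane f (H X)).
Proof.
apply: (iffP (mem_orbit_plane _ _ _)) => -[x [y [z E]]]; exists x, y, z.
  by apply: (can_inj HK); rewrite E cact_H.
by rewrite E cact_H.
Qed.

(** By [mk2_fibre] a plane arises from the q - 1 nonzero multiples of one pair (a, b), and (q^3 - 1)
    (q^3 - q) is divided by q - 1. *)
Lemma total_II2 : total_number (fixed_II2_plane phi sigma q n g)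
  ((q%:Z ^+ 3 - q%:Z) * (q%:Z ^+ 2 + q%:Z + 1)).
Proof.
have q1 := q_gt1.
have -> : (q%:Z ^+ 3 - q%:Z) * (q%:Z ^+ 2 + q%:Z + 1) =
    ((q ^ 3 - q) * (q ^ 2 + q + 1))%N%:Z.
  by rewrite PoszM -subzn ?PoszD // -[X in (X <= _)%N]expn1 leq_exp2l.
pose h (ab : 'rV[F]_3 * 'rV[F]_3) := orbit_plane f (H (mk2 ab.1 ab.2)).
apply: (@total_number_fibres _ _ [set ab | indep ab.1 ab.2] h _ _ q.-1).
- by rewrite -ltnS prednK // (leq_trans _ q1).
- move=> [a b]; rewrite inE /= => ind.
  have -> : [set ab in [set ab | indep ab.1 ab.2] | h ab == h (a, b)] =
      [set (c *: a, c *: b) | c in [set~ 0]].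
    have [cab rab _] := mk2_gen ind.
    apply/setP => -[a' b']; rewrite !inE /h /=; apply/andP/imsetP.
      move=> [ind' /eqP E]; have [cab' rab' _] := mk2_gen ind'.
      have : H (mk2 a' b') \in orbit_plane f (H (mk2 a b)) by rewrite -E orbit_plane_id.
      case/mem_orbit_plane_H => x [y [z /(mk2_fibre ind)[aE bE]]].
      exists x; rewrite ?aE ?bE // !inE; apply: contraTneq ind' => x0.
      by apply/negP => /indep_neq0[/eqP[]]; rewrite aE x0 scale0r.
    move=> [c]; rewrite !inE => cn0 [-> ->].
    have ind' : indep (c *: a) (c *: b).
      apply/indepP => x y; rewrite !scalerA => /(elimT (indepP a b) ind)[/eqP + /eqP].
      by rewrite !mulf_eq0 (negPf cn0) !orbF => /eqP-> /eqP->.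
    split=> //; have [cab' _ _] := mk2_gen ind'.
    apply/eqP/orbit_plane_eq; [exact: f3|exact/cyclic3_H|exact/cyclic3_H|].
    apply/mem_orbit_plane_H; exists c, 0, 0.
    by rewrite /circ !scale0r !addr0 /mk2 mkZ scaler0.
  rewrite card_in_imset ?cardsC1 ?card_F // => c d _ _ [/eqP + _].
  have [a0 _] := indep_neq0 ind.
  by rewrite -subr_eq0 -scalerBl scaler_eq0 (negPf a0) orbF subr_eq0 => /eqP.
- move=> pi; rewrite fixed_II2_planeP; split.
    move=> [v [cv rv /eqP k0 ->]]; move: cv rv k0; rewrite -(GK v).
    move: (G v) => X cX; rewrite rk_H cards_eq0 => rX /eqP k0.
    have [] := mk2_surj rX.
      move=> w w3; rewrite ltnNge; apply/negP => r1.
      have : w \in roots_I (H X); last by rewrite k0 inE.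
      by rewrite roots_I_H w3 eqxx eqn_leq r1 lt0n -rk_minor_H rk_eq0 minor_neq0.
    move=> a [b [x [y [z E]]]].
    have ind : indep a b.
      apply: (@indep_rank _ _ _ X); first by rewrite rX.
      by rewrite E (submx_trans (circ_sub _ _ _ _)) // mk2_sub.
    exists (a, b); rewrite ?inE //; have [/cyclic3_H cab _ _] := mk2_gen ind.
    apply: orbit_plane_eq => //; first exact: f3.
    by apply/mem_orbit_plane_H; exists x, y, z.
  move=> [[a b]]; rewrite inE /= => ind ->; have [cab rab rw] := mk2_gen ind.
  exists (H (mk2 a b)); split=> //; rewrite ?rk_H //; first exact/cyclic3_H.
  apply/eqP; rewrite cards_eq0; apply/eqP/setP => w; rewrite roots_I_H inE.
  by apply/negP => /andP[/eqP/root3_neq0/rw r2 /eqP r1]; rewrite r1 in r2.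
rewrite card_indep; move: q1; case: q => // k _ /=; nia.
Qed.

Local Notation three_eq0 := ((3%:R : F) == 0)%R.

(** The substitution in [mk1_fibre] is triangular with diagonal entries s + 3 t and s; these are the
    pairs (s, t) that keep the two rows independent. *)
Definition scalings_I : {set F * F} :=
  [set st | (st.1 != 0) && (st.1 + 3%:R * st.2 != 0)].

(** In characteristic 3 the two conditions coincide and t is free. Otherwise s + 3 t can replace t
    as a coordinate, and two independent nonzero scalars are counted. *)
Lemma card_scalings_I :
  #|scalings_I| = ((q - 1) * (q - ~~ three_eq0))%N.
Proof.
have cF1 : #|[set~ 0 : F]| = (q - 1)%N by rewrite cardsC1 card_F subn1.
have [c3|c3] := eqVneq (3%:R : F) 0.
  rewrite -cF1 subn0 -card_F -cardsT -cardsX; apply: eq_card => -[s t].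
  by rewrite !inE /= c3 mul0r addr0 andbT andbb.
rewrite -cF1 -cardsX.
rewrite -(card_imset _ (_ : injective (fun sp : F * F => (sp.1, (sp.2 - sp.1) / 3%:R)))).
  apply: eq_card => -[s t]; rewrite !inE /=; apply/andP/imsetP => [[s0 t0]|[[s' p]]].
    by exists (s, s + 3%:R * t); rewrite ?inE ?s0 //=; congr pair; field.
  rewrite !inE /= => /andP[s0 p0] [-> ->]; split=> //.
  by rewrite mulrC divfK // addrC subrK.
move=> [s p] [s' p'] /= [-> /(divIf c3)/addIr->] //.
Qed.

(* By [card_roots] and [card_quad], this number is q - 1 if q = 0 mod 3, and q
   otherwise. *)
Hypothesis gn : q%:Z - 2 + g%:Z - n = (q - three_eq0)%N%:Z.

(** The label w is recovered from the plane through [roots_I], which accounts for the factor g. As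
    (q^3 - 1) (q^3 - q) = q (q - 1)^2 (q + 1) (q^2 + q + 1), fibres of size q (q - 1) in
    characteristic 3 leave the factor q - 1, and fibres of size (q - 1)^2 otherwise leave q. *)
Lemma total_II1 : total_number (fixed_II1_plane S phi sigma q n g)
  (g%:Z * (q%:Z - 2 + g%:Z - n) * (q%:Z + 1) * (q%:Z ^+ 2 + q%:Z + 1)).
Proof.
have q1 := q_gt1.
rewrite gn -[_ * _]/((g * (q - three_eq0) * (q + 1) * (q ^ 2 + q + 1))%N%:Z).
pose h (t : F * 'rV[F]_3 * 'rV[F]_3) := orbit_plane f (H (mk1 t.1.1 t.1.2 t.2)).
pose D := [set t : F * 'rV[F]_3 * 'rV[F]_3 | (t.1.1 ^+ 3 == 1) && indep t.1.2 t.2].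
have rI w a b : w ^+ 3 = 1 -> indep a b -> w \in roots_I (H (mk1 w a b)).
  move=> w3 ind; have [/cyclic3_H cX _ r1] := mk1_gen w3 ind.
  by rewrite roots_I_H w3 eqxx eqn_leq r1 lt0n -rk_minor_H rk_eq0 minor_neq0.
have gen w a b : w ^+ 3 = 1 -> indep a b ->
    cyclic3 (H (mk1 w a b)) /\ rk (H (mk1 w a b)) = 2%N.
  by move=> w3 ind; have [/cyclic3_H cX r2 _] := mk1_gen w3 ind; rewrite rk_H.
apply: (@total_number_fibres _ _ D h _ _ ((q - 1) * (q - ~~ three_eq0))%N).
- rewrite muln_gt0 !subn_gt0 q1; case: eqP => //= _; exact: ltnW.
- move=> [[w a] b]; rewrite inE /= => /andP[/eqP w3 ind].
  have [cX rX] := gen _ _ _ w3 ind.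
  have -> : [set t in D | h t == h (w, a, b)] =
      [set (w, (st.1 + 3%:R * st.2) *: a + st.2 *: b, st.1 *: b) | st in scalings_I].
    apply/setP => -[[w' a'] b']; rewrite !inE /h /=; apply/andP/imsetP.
      move=> [/andP[/eqP w3' ind'] /eqP E]; have [cX' rX'] := gen _ _ _ w3' ind'.
      have mE : H (mk1 w' a' b') \in orbit_plane f (H (mk1 w a b)).
        by rewrite -E orbit_plane_id.
      have ww' : w' = w.
        have wI' : w' \in roots_I (H (mk1 w a b)).
          apply: (roots_I_mem cX cX' _ (rI _ _ _ w3' ind')).
          by rewrite E orbit_plane_id.
        exact: (elimT card_le1_eqP (card_roots_I cX rX) _ _ (rI _ _ _ w3 ind) wI').
      move: mE; rewrite ww' => /mem_orbit_plane_H[x [y [z]]].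
      case/(mk1_fibre w3 ind) => s [t [aE bE]].
      exists (s, t); last by rewrite aE bE.
      rewrite inE /=; move: ind'; rewrite aE bE => ind'.
      have s0 : s != 0.
        apply: contraTneq ind' => ->; apply/negP => /indep_neq0[_ /eqP[]].
        by rewrite scale0r.
      rewrite s0; apply: contraTneq ind' => p0; apply/negP => /indepP ind'.
      have [|/eqP] := ind' s (- t); last by rewrite (negPf s0).
      by rewrite p0 scale0r add0r !scalerA -scalerDl mulNr mulrC subrr scale0r.
    move=> [[s t]]; rewrite !inE /= => /andP[s0 p0] [-> -> ->]; rewrite w3 eqxx /=.
    have ind' : indep ((s + 3%:R * t) *: a + t *: b) (s *: b).
      apply/indepP => x y E.
      have [|/eqP + /eqP] := elimT (indepP a b) ind (x * (s + 3%:R * t)) (x * t + y * s).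
        by rewrite -[RHS]E scalerDr !scalerA scalerDl addrA.
      rewrite mulf_eq0 (negPf p0) orbF => /eqP->; rewrite mul0r add0r.
      by rewrite mulf_eq0 (negPf s0) orbF => /eqP->.
    split=> //; have [cX' _] := gen _ _ _ w3 ind'.
    apply/eqP/orbit_plane_eq; [exact: f3|exact: cX'|exact: cX|].
    by apply/mem_orbit_plane_H; do 3!eexists; exact: mk1_fibre_inv.
  rewrite card_in_imset ?card_scalings_I // => -[s t] [s' t'] _ _ /= [] E1 E2.
  have [_ b0] := indep_neq0 ind.
  have ss : s = s'.
    move/eqP: E2; rewrite -subr_eq0 -scalerBl scaler_eq0 (negPf b0) orbF subr_eq0.
    by move/eqP.
  by have [_ ->] := indep_eq ind E1; rewrite ss.
- move=> pi; rewrite fixed_II1_planeP; split.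
    move=> [v [cv rv /eqP/cards1P[w kw] ->]]; move: cv rv kw; rewrite -(GK v).
    move: (G v) => X cX; rewrite rk_H => rX /setP/(_ w).
    rewrite roots_I_H inE eqxx => /andP[/eqP w3 /eqP r1].
    have [||a [b [x [y [z E]]]]] := @mk1_surj _ w X w3; rewrite ?r1 //.
      exact/cyclic3_H.
    have ind : indep a b.
      apply: (@indep_rank _ _ _ X); first by rewrite rX.
      by rewrite E (submx_trans (circ_sub _ _ _ _)) // mk1_sub.
    exists (w, a, b); first by rewrite inE /= w3 eqxx.
    have [cab _] := gen _ _ _ w3 ind.
    apply: orbit_plane_eq => //; first exact: f3.
    by apply/mem_orbit_plane_H; exists x, y, z.
  move=> [[[w a] b]]; rewrite inE /= => /andP[/eqP w3 ind] ->.
  have [cX rX] := gen _ _ _ w3 ind.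
  exists (H (mk1 w a b)); split=> //.
  have := card_roots_I cX rX; have : (0 < #|roots_I (H (mk1 w a b))|)%N.
    by apply/card_gt0P; exists w; exact: rI.
  by case: #|_| => [|[]].
have -> : #|D| = (g * ((q ^ 3 - 1) * (q ^ 3 - q)))%N.
  rewrite -card_roots -card_indep -cardsX.
  rewrite -(card_imset _ (_ : injective 
    (fun t : F * ('rV[F]_3 * 'rV[F]_3) => (t.1, t.2.1, t.2.2)))).
    apply: eq_card => -[[w a] b]; rewrite !inE /=; apply/idP/imsetP.
      by move=> ?; exists (w, (a, b)); rewrite ?inE.
    by move=> [[w' [a' b']]]; rewrite !inE /= => ? [-> -> ->].
  by move=> [w [a b]] [w' [a' b']] /= [-> -> ->].
have -> : ((q ^ 3 - 1) * (q ^ 3 - q) = q * (q - 1) * ((q - 1) * (q + 1) * (q ^ 2 + q + 1)))%N.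
  move: q1; case: q => // k _ /=; nia.
case: eqP => _ /=; move: (q - 1)%N q (q ^ 2 + q + 1)%N => p r s; rewrite ?subn0 ?subn1; lia.
Qed.

End FixedPlanes.

(** * Cube roots of unity in a finite field *)

Section CubeRoots.

Variable F : finFieldType.

Lemma three_eq0E : (3%:R == 0 :> F) = (3 %| #|F|)%N.
Proof.
have [p pr_p chF] := finPcharP F.
have pF : p.-nat #|F|.
  by have /abelem_pgroup := fin_ring_pchar_abelem chF; rewrite /pgroup cardsT.
rewrite -(dvdn_pcharf chF); apply/idP/idP => [|d3].
  rewrite dvdn_prime2 // => /eqP p3; rewrite p3 in pF.
  have F1 := finNzRing_gt1 F.
  move/pnatP: pF => /(_ (ltnW F1) (pdiv #|F|)); rewrite pdiv_prime // pdiv_dvd !inE.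
  by move=> /(_ isT isT)/eqP <-; exact: pdiv_dvd.
have /pnatP := pF; move=> /(_ (ltnW (finNzRing_gt1 F)) 3%N isT d3).
by rewrite !inE => /eqP <-.
Qed.

(** For q = 0 mod 3 both polynomials are powers of a linear factor with root 1. For q = 1 the
    quadratic has the two primitive cube roots of unity. For q = 2 the only cube root of unity is 1,
    which is not a root of the quadratic since 3 is nonzero. *)
Lemma cube_root_counts (q : nat) (n : int) (g : nat) : #|F| = q ->
    n = -1 \/ n = 0 \/ n = 1 -> (q%:Z = n %[mod 3])%Z -> g = gcdn 3 (q - 1) ->
  [/\ #|[set w : F | w ^+ 3 == 1]| = g,
      #|[set t : F | t ^+ 2 + t + 1 == 0]|%:Z = 1 + n &
      q%:Z - 2 + g%:Z - n = (q - (3%:R == 0 :> F)%R)%N%:Z].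
Proof.
move=> cF n_val q_mod3 gE; have q1 : (1 < q)%N by rewrite -cF finNzRing_gt1.
have cubeE (w : F) : w ^+ 3 - 1 = (w - 1) * (w ^+ 2 + w + 1) by ring.
rewrite three_eq0E cF.
have [n0|n1|n2] : [\/ n = 0 /\ (q %% 3 = 0)%N, n = 1 /\ (q %% 3 = 1)%N
    | n = -1 /\ (q %% 3 = 2)%N].
- by case: n_val => [->|[->|->]] in q_mod3 *; [constructor 3|constructor 1|constructor 2];
    split=> //; lia.
- case: n0 => -> q3; have d3 : (3 %| q)%N by rewrite /dvdn q3.
  have g1 : g = 1%N.
    rewrite gE; apply/eqP; rewrite -/(coprime 3 (q - 1)) prime_coprime //.
    by apply/negP; lia.
  have c3 : 3%:R = 0 :> F by apply/eqP; rewrite three_eq0E cF.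
  rewrite d3 g1; split; last lia.
    rewrite -[RHS](cards1 (1 : F)); apply: eq_card => w; rewrite !inE -[w ^+ 3 == 1]subr_eq0.
    rewrite (_ : w ^+ 3 - 1 = (w - 1) ^+ 3 + 3%:R * w * (w - 1)); last by ring.
    by rewrite c3 !mul0r addr0 expf_eq0 subr_eq0.
  rewrite addr0; congr Posz; rewrite -[RHS](cards1 (1 : F)); apply: eq_card => t; rewrite !inE.
  rewrite (_ : t ^+ 2 + t + 1 = (t - 1) ^+ 2 + 3%:R * t); last by ring.
  by rewrite c3 mul0r addr0 expf_eq0 subr_eq0.
- case: n1 => -> q3; have d3 : (3 %| q.-1)%N by lia.
  have g3 : g = 3%N by rewrite gE subn1; apply/gcdn_idPl.
  have c3 : 3%:R != 0 :> F by rewrite three_eq0E cF; apply/negP; lia.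
  have [x _ ox] : exists2 x, x \in [set: {unit F}] & #[x]%g = 3%N.
    by have [|x] := @Cauchy _ 3 [set: {unit F}]%G isT; [rewrite card_finField_unit cF|exists x].
  pose u : F := val x.
  have u3 : u ^+ 3 = 1.
    by rewrite -FinRing.val_unitX -ox expg_order.
  have u1 : u != 1.
    apply: contra_eq_neq ox => ux; rewrite (_ : x = 1%g) ?order1 //.
    exact/val_inj.
  have u2 : u ^+ 2 + u + 1 = 0.
    have := cubeE u; rewrite u3 subrr => /esym/eqP.
    by rewrite mulf_eq0 subr_eq0 (negPf u1) => /eqP.
  have uu : u != u ^+ 2.
    apply: contraNneq u1 => uE; apply/eqP.
    by have := u3; rewrite exprS -uE -expr2 -uE.
  have uu1 : u ^+ 2 != 1.
    by apply: contra_eq_neq u3 => uE; rewrite exprS uE mulr1.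
  have quadE (w : F) : w ^+ 2 + w + 1 = (w - u) * (w - u ^+ 2).
    rewrite (_ : (w - u) * _ = w ^+ 2 + w + u ^+ 3 - (u ^+ 2 + u + 1) * w); last by ring.
    by rewrite u2 u3 mul0r subr0.
  rewrite g3; split; last first.
  - by rewrite (_ : (3 %| q)%N = false); [lia|apply/negP; lia].
  - rewrite (_ : [set t | _] = [set u; u ^+ 2]) ?cards2 ?uu //.
    by apply/setP => t; rewrite !inE quadE mulf_eq0 !subr_eq0.
  - rewrite (_ : [set w | _] = [set 1; u; u ^+ 2]); last first.
      apply/setP => w; rewrite !inE -subr_eq0 cubeE quadE !mulf_eq0 !subr_eq0.
      by rewrite orbA.
    rewrite -setUA cardsU1 cards2 uu !inE eq_sym (negPf u1).
    by rewrite eq_sym (negPf uu1).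
case: n2 => -> q3.
have nd3 : (3 %| q)%N = false by apply/negP; lia.
have g1 : g = 1%N.
  rewrite gE; apply/eqP; rewrite -/(coprime 3 (q - 1)) prime_coprime //.
  by apply/negP; lia.
have c3 : 3%:R != 0 :> F by rewrite three_eq0E cF nd3.
have root1 (w : F) : w ^+ 3 = 1 -> w = 1.
  move=> w3; have w0 := root3_neq0 w3.
  (* With q = 3 k + 2 and w^3 = 1, the identity w^q = w reads w^2 = w. *)
  have := expf_card w; rewrite cF (divn_eq q 3) q3 exprD mulnC exprM w3 expr1n mul1r.
  by rewrite -[RHS]mulr1 expr2 => /(mulfI w0).
rewrite nd3 g1; split; last lia.
  rewrite -[RHS](cards1 (1 : F)); apply: eq_card => w; rewrite !inE.
  by apply/eqP/eqP => [/root1//|->]; rewrite expr1n.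
rewrite subrr; congr Posz; apply/eqP; rewrite cards_eq0; apply/eqP/setP => t.
rewrite !inE; apply/negP => /eqP t0.
have t1 : t = 1 by apply: root1; apply/eqP; rewrite -subr_eq0 cubeE t0 mulr0.
by case/eqP: c3; rewrite -t0 t1; ring.
Qed.

End CubeRoots.

(** * The automorphism tau: independence, fixed field, Hilbert 90, normal basis *)

Section CubicExtension.

Variables (F : finFieldType) (L : fieldExtType F) (tau : 'End(L)).
Hypothesis dimL : \dim {:L} = 3%N.
Hypothesis tau1 : tau 1 = 1.
Hypothesis tauM : {morph tau : x y / x * y}.
Hypothesis tau3 : forall x, tau (tau (tau x)) = x.
Hypothesis tau_neq : exists y, tau y != y.
Implicit Types a b c x y u : L.

Lemma tau_inj : injective tau.
Proof. by move=> x y E; rewrite -(tau3 x) E tau3. Qed.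

Lemma tau_eq0 x : (tau x == 0) = (x == 0).
Proof. by rewrite -{1}(linear0 tau) (inj_eq tau_inj). Qed.

Lemma tauV x : tau x^-1 = (tau x)^-1.
Proof.
have [->|x0] := eqVneq x 0; first by rewrite linear0 !invr0 linear0.
apply: (mulfI (_ : tau x != 0)); first by rewrite tau_eq0.
by rewrite -tauM !divff ?tau_eq0.
Qed.

(** Dedekind's independence of characters: subtracting tau^2(y) times the relation at x from the
    relation at x y eliminates c, and a second such step eliminates b. *)
Lemma dedekind3 a b c : (forall x, a * x + b * tau x + c * tau (tau x) = 0) ->
  [/\ a = 0, b = 0 & c = 0].
Proof.
move=> E; have [y ty] := tau_neq.
have ty1 : y - tau y != 0 by rewrite subr_eq0 eq_sym.
have ty2 : y - tau (tau y) != 0.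
  rewrite subr_eq0; apply: contraNneq ty => y2.
  by rewrite {1}y2 tau3.
have ty3 : tau y - tau (tau y) != 0 by rewrite -linearB tau_eq0.
have E2 x : a * (y - tau (tau y)) * x + b * (tau y - tau (tau y)) * tau x = 0.
  rewrite -[RHS](subrr 0) -{1}(E (x * y)) -[X in _ = _ - X](mulr0 (tau (tau y))).
  by rewrite -(E x) !tauM; ring.
have E3 : a * (y - tau (tau y)) * (y - tau y) = 0.
  rewrite -[RHS](subrr 0) -{1}(E2 y) -[X in _ = _ - X](mulr0 (tau y)) -(E2 1) tau1.
  by ring.
have a0 : a = 0.
  by move/eqP: E3; rewrite !mulf_eq0 (negPf ty1) (negPf ty2) !orbF => /eqP.
have b0 : b = 0.
  have := E2 1; rewrite a0 tau1 !mul0r add0r mulr1 => /eqP.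
  by rewrite mulf_eq0 (negPf ty3) orbF => /eqP.
split=> //; have := E 1; rewrite a0 b0 !tau1 !mul0r !add0r mulr1.
by [].
Qed.

(** The fixed field is intermediate in an extension of prime degree 3, and it is not L since tau
    moves some element. *)
Lemma tau_fixed x : tau x = x -> exists k : F, x = k *: 1.
Proof.
move=> tx.
have hom : ahom_in {:L} tau by apply/ahom_inP; split=> // y z _ _; exact: tauM.
pose K : {aspace L} := fixedSpace_aspace (AHom hom).
have memK y : (y \in K) = (tau y == y) by apply/fixedSpaceP/eqP.
have : (\dim K %| \dim {:L})%N by apply: field_dimS; exact: subvf.
rewrite dimL dvdn_divisors // !inE => /orP[/eqP d1|/eqP d3]; last first.
  have [y /negP[]] := tau_neq; rewrite -memK.
  have -> : (K : {vspace L}) = {:L}%VS by apply/eqP; rewrite eqEdim subvf d3 dimL.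
  exact: memvf.
have K1 : (K : {vspace L}) = 1%VS.
  by apply/esym/eqP; rewrite eqEdim d1 dimv1 -memvE memK tau1 eqxx.
have : x \in (K : {vspace L}) by rewrite memK tx.
by rewrite K1 => /vlineP.
Qed.

(** The witness is a nonzero value of the resolvent x + c tau(x) + c tau(c) tau^2(x); [dedekind3]
    provides one, and applying c tau permutes the three terms because c has norm 1. *)
Lemma hilbert90 c : c * tau c * tau (tau c) = 1 -> exists2 u, u != 0 & c * tau u = u.
Proof.
move=> Nc; pose h := (\1 + (amull c \o tau) + (amull (c * tau c) \o tau \o tau))%VF.
have hE x : h x = x + c * tau x + c * tau c * tau (tau x).
  by rewrite /h !add_lfunE !comp_lfunE id_lfunE !lfunE.
have [h0|] := eqVneq h 0.
  have [|/eqP] := @dedekind3 1 c (c * tau c); last by rewrite oner_eq0.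
  by move=> x; rewrite mul1r -hE h0 zero_lfunE.
case/lfunPn => x; rewrite zero_lfunE => hx; exists (h x) => //.
rewrite hE !linearD /= !tauM tau3.
rewrite (_ : c * _ = c * tau x + c * tau c * tau (tau x) + (c * tau c * tau (tau c)) * x).
  by rewrite Nc mul1r; ring.
by ring.
Qed.

(* By the trichotomy, a vector that is not cyclic is killed by tau - w or by
   tau^2 + w tau + w^2 for some w with w^3 = 1: these kernels are too small. *)
Lemma normal_basis : (#|[set w : F | (w ^+ 3 == 1)%R]| * (#|F| + #|F| ^ 2) < #|F| ^ 3)%N ->
  exists b, cyclic3 tau b.
Proof.
move=> small; set q := #|F| in small *.
pose T : finType := finvect_type L.
pose E (w : F) := [set x : T | tau x == w *: (x : L)].
pose Q (w : F) := [set x : T | cact tau (w ^+ 2) w 1 x == 0].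
have cT : #|T| = (q ^ 3)%N.
  have := @card_vspace F T _ {:L}%VS; rewrite dimL => <-.
  by apply/esym/eq_card => x; rewrite memvf.
(* The quotient of any vector of [E w] by a nonzero one is fixed by tau, hence a scalar of F. *)
have cE w : (#|E w| <= q)%N.
  case: (pickP [pred x : T | (tau x == w *: (x : L)) && ((x : L) != 0)]); last first.
    move=> none; have /subset_leq_card : E w \subset [set (0 : T)].
      apply/subsetP => x; rewrite !inE => xE.
      by move: (none x) => /=; rewrite xE => /negbFE.
    by move/leq_trans; apply; rewrite cards1 ltnW // finNzRing_gt1.
  move=> x /andP[xE xn0].
  have : E w \subset [set (k *: (x : L) : T) | k in F].
    apply/subsetP => y yE; move: xE yE; rewrite inE => /eqP xE /eqP yE.
    have [|k kE] := @tau_fixed ((y : L) / x).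
      have w0 : w != 0.
        apply: contraNneq xn0 => w0; move: xE; rewrite w0 scale0r => /eqP.
        by rewrite tau_eq0.
      rewrite tauM tauV yE xE -(mulr_algl w y) -(mulr_algl w x) invfM mulrACA.
      rewrite divff ?mul1r //.
      by rewrite scaler_eq0 oner_eq0 orbF.
    apply/imsetP; exists k => //.
    by rewrite -[LHS](divfK (xn0 : (x : L) != 0)) kE mulr_algl.
  by move/subset_leq_card/leq_trans; apply; rewrite (leq_trans (leq_imset_card _ _)).
(* By [dedekind3] the operator tau^2 + w tau + w^2 is not zero, so its kernel is a proper
   subspace. *)
have cQ w : (#|Q w| <= q ^ 2)%N.
  pose h := (w ^+ 2 *: \1 + w *: tau + (tau \o tau))%VF.
  have hE x : h x = cact tau (w ^+ 2) w 1 x.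
    by rewrite /h !add_lfunE !comp_lfunE !scale_lfunE id_lfunE /cact scale1r.
  have -> : #|Q w| = (q ^ \dim (lker h))%N.
    rewrite -(@card_vspace F T _ (lker h)); apply: eq_card => x.
    by rewrite inE memv_ker hE.
  rewrite leq_pexp2l //; first by rewrite ltnW // finNzRing_gt1.
  rewrite -ltnS -dimL ltn_neqAle dimvS ?subvf // andbT.
  apply/negP => /eqP dk.
  have kf : lker h = {:L}%VS by apply/eqP; rewrite eqEdim subvf dk leqnn.
  have [|_ _ /eqP] := @dedekind3 (w ^+ 2 *: 1) (w *: 1) 1; last by rewrite oner_eq0.
  move=> x; rewrite !mulr_algl mul1r -[X in _ + X]scale1r -/(cact tau _ _ _ x) -hE.
  by apply/eqP; rewrite -memv_ker kf memvf.
have [/existsP[b cb]|] := boolP [exists b : T, cyclic3 tau b]; first by exists b.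
rewrite negb_exists => /forallP nc.
have : (#|T| <= #|\bigcup_(w in [set w : F | (w ^+ 3 == 1)%R]) (E w :|: Q w)|)%N.
  rewrite -cardsT; apply/subset_leq_card/subsetP => x _; apply/bigcupP.
  have [x0|x0] := eqVneq (x : L) 0.
    by exists 1; rewrite !inE ?expr1n // x0 linear0 scaler0 eqxx.
  have [[w w3 Ew]|[w w3 /andP[_ qx]]|cx] := cyclic_trichotomy tau3 x0.
  - by exists w; rewrite !inE ?w3 // Ew eqxx.
  - by exists w; rewrite !inE ?w3 // cact_quadE qx orbT.
  - by move: (nc x); rewrite cx.
rewrite leqNgt => /negP[]; rewrite cT; apply: leq_ltn_trans small.
rewrite -sum_nat_const; elim/big_ind2: _ => [|A m B k Am Bk|w _].
- by rewrite cards0.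
- by rewrite (leq_trans (leq_card_setU _ _)) // leq_add.
- by rewrite (leq_trans (leq_card_setU _ _)) // leq_add.
Qed.

End CubicExtension.

(** * Collineations as automorphisms of the subspace lattice *)

Section Collineation.

Variables (K : fieldType) (vT : vectType K) (phi : {vspace vT} -> {vspace vT}).
Hypothesis phi_col : collineation phi.

Lemma collineation_inj : injective phi.
Proof. by case: phi_col => /bij_inj. Qed.

Lemma collineation0 : phi 0%VS = 0%VS.
Proof.
have [[psi _ psiK] le_phi] := phi_col.
by apply/eqP; rewrite -subv0 -[X in (_ <= X)%VS]psiK le_phi sub0v.
Qed.

(** Points are the minimal nonzero subspaces: the preimage of a point inside phi P is a nonzero
    subspace of P, hence P. *)
Lemma dim_collineation1 P : \dim P = 1%N -> \dim (phi P) = 1%N.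
Proof.
have [[psi phiK psiK] le_phi] := phi_col.
move=> dP; have Pn0 : P != 0%VS by rewrite -dimv_eq0 dP.
have pPn0 : phi P != 0%VS by rewrite -collineation0 (inj_eq collineation_inj).
pose u := vpick (phi P); have un0 : u != 0 by rewrite vpick0.
have up : (<[u]> <= phi P)%VS by rewrite -memvE memv_pick.
suff <- : <[u]>%VS = phi P by rewrite dim_vline1.
have sQ : (psi <[u]> <= P)%VS by rewrite -le_phi psiK.
have Qn0 : psi <[u]>%VS != 0%VS.
  rewrite -(inj_eq collineation_inj) psiK collineation0.
  by rewrite -dimv_eq0 dim_vline1.
suff <- : psi <[u]>%VS = P by rewrite psiK.
by apply/eqP; rewrite eqEdim sQ dP lt0n dimv_eq0.
Qed.

Lemma collineation_id : (forall P, \dim P = 1%N -> phi P = P) -> forall U, phi U = U.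
Proof.
have [_ le_phi] := phi_col => fixP U.
have lineE v : (<[v]> <= phi U)%VS = (<[v]> <= U)%VS.
  have [->|v0] := eqVneq v 0; first by rewrite -!memvE !mem0v.
  by rewrite -[in LHS](fixP <[v]>%VS) ?dim_vline1.
by apply/vspaceP => v; rewrite !memvE lineE.
Qed.

End Collineation.

Definition unbose (F : fieldType) (L : fieldExtType F) (w : bose_space L) :
  'rV[L]_3 := \row_i w i.

Section Unbose.

Variables (F : fieldType) (L : fieldExtType F).

Lemma unboseK (w : bose_space L) : bose_vec (unbose w) = w.
Proof. by apply/ffunP => i; rewrite ffunE mxE. Qed.

Lemma bose_vecD (u v : 'rV[L]_3) : bose_vec (u + v) = bose_vec u + bose_vec v.
Proof. by apply/ffunP => i; rewrite !ffunE mxE. Qed.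

Lemma bose_vec0 : bose_vec (0 : 'rV[L]_3) = 0.
Proof. by apply/ffunP => i; rewrite !ffunE mxE. Qed.

End Unbose.

Lemma map_mulmx_neq0 (F : fieldType) (L : fieldExtType F) (N : 'M[L]_3)
  (a : 'rV[F]_3) : N \in unitmx -> a != 0 -> map_mx (in_alg L) a *m N != 0.
Proof.
move=> uN; apply: contra_neq => /(congr1 (mulmxr (invmx N))) /=.
rewrite mulmxK // mul0mx => a0.
by apply: (@map_mx_inj _ _ (in_alg L)); rewrite map_mx0.
Qed.

(** * The lift f is semilinear over L *)

Section Semilinear.

Variables (F : finFieldType) (L : fieldExtType F).
Variable S : {vspace 'rV[L]_3} -> Prop.
Variable phi : {vspace 'rV[L]_3} -> {vspace 'rV[L]_3}.
Variable f : 'End(bose_space L).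
Hypothesis phi_col : collineation phi.
Hypothesis phi_order3 : order3 phi.
Hypothesis phi_fix : forall P, S P -> phi P = P.
Hypothesis f3 : forall w, f (f (f w)) = w.
Hypothesis f_bose : forall P, \dim P = 1%N -> (f @: bose P)%VS = bose (phi P).

Definition fvec (v : 'rV[L]_3) : 'rV[L]_3 := unbose (f (bose_vec v)).

Lemma fvecE v : bose_vec (fvec v) = f (bose_vec v).
Proof. exact: unboseK. Qed.

Lemma bose_vec_inj : injective (@bose_vec F L).
Proof. exact: can_inj (@bose_vecK F L). Qed.

Lemma fvecD u v : fvec (u + v) = fvec u + fvec v.
Proof. by apply: bose_vec_inj; rewrite bose_vecD !fvecE bose_vecD linearD. Qed.

Lemma fvecZ (k : F) v : fvec (k%:A *: v) = k%:A *: fvec v.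
Proof. by apply: bose_vec_inj; rewrite bose_vecZ !fvecE bose_vecZ linearZ. Qed.

Lemma fvec0 : fvec 0 = 0.
Proof. by apply: bose_vec_inj; rewrite fvecE bose_vec0 linear0. Qed.

Lemma fvec3 v : fvec (fvec (fvec v)) = v.
Proof. by apply: bose_vec_inj; rewrite !fvecE f3. Qed.

Lemma fvec_inj : injective fvec.
Proof. by move=> u v E; rewrite -(fvec3 u) E fvec3. Qed.

Lemma fvec_eq0 v : (fvec v == 0) = (v == 0).
Proof. by rewrite -{1}fvec0 (inj_eq fvec_inj). Qed.

Lemma phi_vline v : v != 0 -> phi <[v]>%VS = <[fvec v]>%VS.
Proof.
move=> v0; apply/esym/eqP; rewrite eqEdim dim_vline1 ?fvec_eq0 //.
rewrite (dim_collineation1 phi_col) ?dim_vline1 // andbT -memvE -mem_bose fvecE.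
by rewrite -f_bose ?dim_vline1 // memv_img // mem_bose memv_line.
Qed.

(** A priori f is only F-linear; that it maps each [[P]] onto [[P^phi]] makes it preserve
    proportionality over L. *)
Lemma fvec_line (l : L) v : exists m, fvec (l *: v) = m *: fvec v.
Proof.
have [->|v0] := eqVneq v 0; first by exists 0; rewrite scaler0 fvec0 scaler0.
have [->|l0] := eqVneq l 0; first by exists 0; rewrite !scale0r fvec0.
have lv0 : l *: v != 0 by rewrite scaler_eq0 negb_or l0.
apply/vlineP; rewrite -phi_vline //.
have <- : <[l *: v]>%VS = <[v]>%VS by apply/eqP/eq_vlineP => //; exists l.
by rewrite phi_vline // memv_line.
Qed.

Variable M : 'M[L]_3.
Hypothesis M_unit : M \in unitmx.
Hypothesis SE : forall P, S P <->
  exists2 a : 'rV[F]_3, a != 0 & P = <[map_mx (in_alg L) a *m M]>%VS.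

(** The lift in the coordinates given by M, for which the subplane is PG(2, q). *)
Let fc (x : 'rV[L]_3) := fvec (x *m M) *m invmx M.

Let fcE x : fvec (x *m M) = fc x *m M.
Proof. by rewrite mulmxKV. Qed.

Let fcD x y : fc (x + y) = fc x + fc y.
Proof. by rewrite /fc mulmxDl fvecD mulmxDl. Qed.

Let fcZ (k : F) x : fc (k%:A *: x) = k%:A *: fc x.
Proof. by rewrite /fc -scalemxAl fvecZ -scalemxAl. Qed.

Let fc0 : fc 0 = 0.
Proof. by rewrite /fc mul0mx fvec0 mul0mx. Qed.

Let fc_line (l : L) x : exists m, fc (l *: x) = m *: fc x.
Proof.
by rewrite /fc -scalemxAl; have [m ->] := fvec_line l (x *m M); exists m; rewrite -scalemxAl.
Qed.

Let fc3 x : fc (fc (fc x)) = x.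
Proof. by rewrite /fc !mulmxKV // fvec3 mulmxK. Qed.

Let fc_fixed (a : 'rV[F]_3) : exists c, fc (map_mx (in_alg L) a) = c *: map_mx (in_alg L) a.
Proof.
have [->|a0] := eqVneq a 0; first by exists 0; rewrite map_mx0 fc0 scaler0.
set x := map_mx _ a.
have x0 : x *m M != 0 by apply: map_mulmx_neq0.
have : fvec (x *m M) \in <[x *m M]>%VS.
  have /phi_fix : S <[x *m M]>%VS by apply/SE; exists a.
  by rewrite phi_vline // => <-; exact: memv_line.
by case/vlineP => c E; exists c; rewrite /fc E -scalemxAl mulmxK.
Qed.

(* Comparing the images of l e_i and of l (1, 1, 1) gives one map tau with
   f (l e_i) = c (tau l) e_i for all i, and the line through (1, m, 0) shows
   that tau is multiplicative. *)
Lemma semilinear_form : exists (tau : 'End(L)) (N : 'M[L]_3),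
  [/\ [/\ tau 1 = 1, {morph tau : x y / x * y}, forall x, tau (tau (tau x)) = x
        & exists y, tau y != y],
      N \in unitmx,
      forall x, fvec (x *m N) = map_mx tau x *m N &
      forall P, S P <->
        exists2 a : 'rV[F]_3, a != 0 & P = <[map_mx (in_alg L) a *m N]>%VS].
Proof.
pose e (i : 'I_3) : 'rV[L]_3 := delta_mx 0 i.
pose o : 'rV[L]_3 := const_mx 1.
have oE : o = e 0 + e 1 + e 2%:R.
  by apply/rowP; apply: forall_ord3; rewrite !mxE /= !(addr0, add0r).
have fce i : exists c, fc (e i) = c *: e i.
  have := fc_fixed (delta_mx 0 i); rewrite map_delta_mx; exact.
have [c cE] : exists c, fc o = c *: o.
  have [c] := fc_fixed (const_mx 1); rewrite map_const_mx rmorph1; by exists c.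
have entry (x y z : L) : x *: e 0 + y *: e 1 + z *: e 2%:R = \row_i [:: x; y; z]`_i.
  apply/rowP; apply: forall_ord3; rewrite !mxE /= !(mulr0, mulr1, addr0, add0r) //.
have rowE (x : 'rV[L]_3) : x = x 0 0 *: e 0 + x 0 1 *: e 1 + x 0 2%:R *: e 2%:R.
  by rewrite entry; apply/rowP; apply: forall_ord3; rewrite mxE.
have c0 : c != 0.
  apply/eqP => c0; have := fc3 o; rewrite cE c0 scale0r !fc0 => /rowP/(_ 0)/eqP.
  by rewrite !mxE eq_sym oner_eq0.
(* Any coordinate of the image of (l, l, l) would do; division by c makes T 1 = 1. *)
pose T (l : L) := c^-1 * fc (l *: o) 0 0.
have fcl l i : fc (l *: e i) = (c * T l) *: e i.
  have H j : exists m, fc (l *: e j) = m *: e j.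
    by have [m ->] := fc_line l (e j); have [d ->] := fce j; exists (m * d); rewrite scalerA.
  have [m0 E0] := H 0; have [m1 E1] := H 1; have [m2 E2] := H 2%:R.
  have [m] := fc_line l o; rewrite cE scalerA => Eo.
  have : fc (l *: o) = \row_i [:: m0; m1; m2]`_i.
    by rewrite oE !scalerDr !fcD E0 E1 E2 entry.
  rewrite /T mulVKf // Eo => /rowP R.
  have := R 0; have := R 1; have := R 2%:R; rewrite !mxE /= mulr1 => R2 R1 R0.
  by move: i; apply: forall_ord3; rewrite ?E0 ?E1 ?E2 -?R0 -?R1 -?R2.
have fcT x : fc x = c *: map_mx T x.
  rewrite {1}(rowE x) !fcD !fcl entry; apply/rowP; apply: forall_ord3;
  by rewrite !mxE.
have TD x y : T (x + y) = T x + T y by rewrite /T scalerDl fcD mxE mulrDr.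
have TZ (k : F) x : T (k *: x) = k *: T x.
  by rewrite /T -mulr_algl -scalerA fcZ mxE mulrCA mulr_algl.
have T1 : T 1 = 1 by rewrite /T scale1r cE !mxE mulr1 mulVf.
have TM : {morph T : x y / x * y}.
  move=> l m; pose x : 'rV[L]_3 := \row_i [:: 1; m; 0]`_i.
  have [k] := fc_line l x; rewrite !fcT => /rowP R.
  have := R 1; have := R 0; rewrite !mxE /= mulr1 T1 mulr1 => R0.
  have kE : k = T l by apply: (mulfI c0); rewrite R0 mulrC.
  by move=> R1; apply: (mulfI c0); rewrite R1 kE; ring.
(* The cube of x |-> c T(x) is the identity; the case l = 1 says that c has norm 1, and then T^3 = 1
   follows. *)
have N3 l : c * T c * T (T c) * T (T (T l)) = l.
  have := fc3 (l *: o); rewrite !fcT => /rowP/(_ 0); rewrite !mxE mulr1 => E.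
  by rewrite -[RHS]E !TM; ring.
have Nc : c * T c * T (T c) = 1 by have := N3 1; rewrite !T1 mulr1.
have T3 l : T (T (T l)) = l by have := N3 l; rewrite Nc mul1r.
have Tlin : linear T by move=> k x y; rewrite TD TZ.
pose Tl : {linear L -> L} := HB.pack T (GRing.isLinear.Build F L L _ T Tlin).
pose tau := linfun Tl.
have tE : tau =1 T by move=> x; rewrite lfunE.
have mtE (x : 'rV[L]_3) : map_mx tau x = map_mx T x by apply/rowP => i; rewrite !mxE tE.
(* If tau were the identity, f would be multiplication by c and phi would fix every point, hence
   every subspace, against its order. *)
have tau_n1 : exists y, tau y != y.
  have [t1|] := eqVneq tau \1%VF; last by case/lfunPn => y; rewrite id_lfunE; exists y.
  have [_ [U []]] := phi_order3; apply: collineation_id => // P /dim1_vline[v v0 ->].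
  rewrite phi_vline //; apply/eqP/eq_vlineP => //; exists c => //.
  rewrite -[v](mulmxKV M_unit) fcE fcT scalemxAl; congr (_ *m _); congr (_ *: _).
  by apply/rowP => i; rewrite !mxE -tE t1 id_lfunE.
have [u u0 uE] : exists2 u, u != 0 & c * tau u = u.
  apply: hilbert90 => //; rewrite ?tE //; [move=> x y|move=> x]; by rewrite !tE.
(* Since c tau(u) = u, the change of basis from M to u M absorbs c; it does not change the points of
   the subplane. *)
exists tau, (u *: M); split.
- by split=> //; rewrite ?tE // => x *; rewrite !tE.
- by rewrite unitmxZ ?unitfE.
- move=> x; rewrite -!scalemxAr !scalemxAl fcE fcT mtE; congr (_ *m _).
  apply/rowP => i; rewrite !mxE TM -{2}uE tE; ring.
move=> P; rewrite SE; split=> -[a a0 ->]; exists a => //;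
  rewrite -scalemxAr; [apply/esym|]; apply/eqP/eq_vlineP; rewrite ?map_mulmx_neq0 //;
  by exists u.
Qed.

End Semilinear.

(** * The matrix model: types of points as ranks *)

Section Coordinates.

Variables (F : finFieldType) (L : fieldExtType F).
Variable S : {vspace 'rV[L]_3} -> Prop.
Variable phi : {vspace 'rV[L]_3} -> {vspace 'rV[L]_3}.
Variable f : 'End(bose_space L).
Variables (tau : 'End(L)) (N : 'M[L]_3) (b : L).
Hypothesis dimL : \dim {:L} = 3%N.
Hypothesis phi_inj : injective phi.
Hypothesis phi3 : forall U, phi (phi (phi U)) = U.
Hypothesis phiE : forall v, v != 0 -> phi <[v]>%VS = <[fvec f v]>%VS.
Hypothesis tau1 : tau 1 = 1.
Hypothesis tauM : {morph tau : x y / x * y}.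
Hypothesis tau3 : forall x, tau (tau (tau x)) = x.
Hypothesis tau_neq : exists y, tau y != y.
Hypothesis N_unit : N \in unitmx.
Hypothesis fvecN : forall x, fvec f (x *m N) = map_mx tau x *m N.
Hypothesis SE : forall P, S P <->
  exists2 a : 'rV[F]_3, a != 0 & P = <[map_mx (in_alg L) a *m N]>%VS.
Hypothesis cb : cyclic3 tau b.
Implicit Types X Y : 'M[F]_3.

Definition nbasis : 'rV[L]_3 := \row_i [:: b; tau b; tau (tau b)]`_i.

Definition comb k (X : 'M[F]_(3, k)) : 'rV[L]_k := nbasis *m map_mx (in_alg L) X.

Local Notation bt := [tuple b; tau b; tau (tau b)].

Definition decomb k (y : 'rV[L]_k) : 'M[F]_(3, k) := \matrix_(i, j) coord bt i (y 0 j).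

Lemma combE k (X : 'M[F]_(3, k)) j : comb X 0 j = \sum_i X i j *: bt`_i.
Proof. by rewrite mxE; apply: eq_bigr => i _; rewrite !mxE mulr_algr. Qed.

Lemma combK k : cancel (@comb k) (@decomb k).
Proof.
by move=> X; apply/matrixP => i j; rewrite mxE combE coord_sum_free.
Qed.

Lemma decombK k : cancel (@decomb k) (@comb k).
Proof.
move=> y; apply/rowP => j; rewrite combE.
have bb : basis_of {:L} bt 
  by rewrite basisEfree; apply/and3P; split; [exact: cb|exact: subvf|rewrite dimL].
by rewrite [RHS](coord_basis bb (memvf _)); apply: eq_bigr => i _; rewrite mxE.
Qed.

Lemma combD k (X Y : 'M[F]_(3, k)) : comb (X + Y) = comb X + comb Y.
Proof. by rewrite /comb map_mxD mulmxDr. Qed.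

Lemma combZ k c (X : 'M[F]_(3, k)) : comb (c *: X) = c%:A *: comb X.
Proof. by rewrite /comb map_mxZ -scalemxAr. Qed.

Lemma combM k l (X : 'M[F]_(3, k)) (Y : 'M[F]_(k, l)) :
  comb (X *m Y) = comb X *m map_mx (in_alg L) Y.
Proof. by rewrite /comb map_mxM mulmxA. Qed.

Lemma comb0 k : comb (0 : 'M[F]_(3, k)) = 0.
Proof. by rewrite /comb map_mx0 mulmx0. Qed.

Lemma comb_eq0 k (X : 'M[F]_(3, k)) : (comb X == 0) = (X == 0).
Proof. by rewrite -{1}(comb0 k) (inj_eq (can_inj (@combK k))). Qed.

Lemma tau_mulmx k (x : 'rV[L]_3) (X : 'M[F]_(3, k)) :
  map_mx tau (x *m map_mx (in_alg L) X) = map_mx tau x *m map_mx (in_alg L) X.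
Proof.
apply/rowP => j; rewrite !mxE linear_sum; apply: eq_bigr => i _.
by rewrite !mxE /= !mulr_algr linearZ.
Qed.

Lemma tau_nbasis : map_mx tau nbasis = nbasis *m map_mx (in_alg L) (shift F).
Proof.
apply/rowP; apply: forall_ord3; rewrite !mxE big_ord3 !mxE /= !scale1r !scale0r;
by rewrite !(mulr0, mulr1, addr0, add0r) ?tau3.
Qed.

Lemma tau_comb X : map_mx tau (comb X) = comb (shift F *m X).
Proof. by rewrite /comb tau_mulmx tau_nbasis -mulmxA -map_mxM. Qed.

Definition model (X : 'M[F]_3) : bose_space L := bose_vec (comb X *m N).

Definition model_inv (w : bose_space L) : 'M[F]_3 := decomb (unbose w *m invmx N).

Lemma modelK : cancel model model_inv.
Proof.
by move=> X; rewrite /model /model_inv /unbose bose_vecK mulmxK // combK.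
Qed.

Lemma model_invK : cancel model_inv model.
Proof.
by move=> w; rewrite /model /model_inv decombK mulmxKV // unboseK.
Qed.

Lemma model_is_linear : linear model.
Proof.
by move=> c X Y; rewrite /model combD combZ mulmxDl -scalemxAl bose_vecD bose_vecZ.
Qed.

Lemma f_model X : f (model X) = model (shift F *m X).
Proof. by rewrite /model -fvecE fvecN tau_comb. Qed.

Lemma comb_N_neq0 X : X != 0 -> comb X *m N != 0.
Proof.
rewrite -comb_eq0; apply: contra_neq => /(congr1 (mulmxr (invmx N))) /=.
by rewrite mulmxK // mul0mx.
Qed.

Lemma model_neq0 X : X != 0 -> model X != 0.
Proof.
move=> X0; rewrite /model -(bose_vec0 L); apply: contra_neq (comb_N_neq0 X0).
exact: bose_vec_inj.
Qed.

(** A rank 1 factorisation X = D a, with D a column, becomes the vector l a where l has the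
    coordinates D in the normal basis. *)
Lemma rank_le1P X : (\rank X <= 1)%N <->
  exists l (a : 'rV[F]_3), comb X = l *: map_mx (in_alg L) a.
Proof.
split=> [/rank1_sub[a _ /submxP[D XE]]|[l [a XE]]].
  exists (comb D 0 0), a.
  by rewrite XE combM [comb D]mx11_scalar mul_scalar_mx !mxE eqxx mulr1n.
have -> : X = decomb (l%:M : 'rV_1) *m a.
  by apply: (can_inj (@combK 3)); rewrite combM decombK mul_scalar_mx.
by apply: (@rank_sub1 _ a); exact: submxMl.
Qed.

Lemma model_type_I A :
  type_point S A <-> exists2 X, \rank X = 1%N & A = <[model X]>%VS.
Proof.
split.
  move=> [/dim1_vline[w w0 ->] [_ [_ /SE[a a0 ->]]]].
  move: w0; rewrite -(model_invK w); move: (model_inv w) => X X0.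
  rewrite -memvE mem_bose => /vlineP[l E]; exists X => //.
  apply/eqP; rewrite eqn_leq; apply/andP; split.
    apply/rank_le1P; exists l, a.
    by apply: (can_inj (mulmxK N_unit)); rewrite E scalemxAl.
  rewrite lt0n mxrank_eq0; apply: contraNneq X0 => ->.
  by rewrite /model comb0 mul0mx bose_vec0.
move=> [X r1 ->].
have X0 : X != 0 by rewrite -mxrank_eq0 r1.
split; first by rewrite dim_vline1 ?model_neq0.
have /rank_le1P[l [a XE]] : (\rank X <= 1)%N by rewrite r1.
have a0 : a != 0.
  by apply: contraNneq X0 => a0; rewrite -comb_eq0 XE a0 map_mx0 scaler0.
exists <[map_mx (in_alg L) a *m N]>%VS; split.
- by rewrite dim_vline1 ?map_mulmx_neq0.
- by apply/SE; exists a.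
- by rewrite -memvE mem_bose XE -scalemxAl memvZ ?memv_line.
Qed.

Lemma phi_comb X : X != 0 ->
  phi <[comb X *m N]>%VS = <[comb (shift F *m X) *m N]>%VS.
Proof. by move=> X0; rewrite phiE ?comb_N_neq0 // fvecN tau_comb. Qed.

(** If tau x = c x, the quotients of the entries of x by a nonzero entry are fixed by tau, hence in
    F: the points fixed by phi are those of the subplane. *)
Lemma phi_fixed_rank X : X != 0 ->
  phi <[comb X *m N]>%VS = <[comb X *m N]>%VS <-> (\rank X <= 1)%N.
Proof.
move=> X0; have v0 := comb_N_neq0 X0; rewrite phi_comb // -tau_comb.
split=> [/eqP/(eq_vlineP _ v0)[c _ E]|/rank_le1P[l [a XE]]].
  have {E}E : map_mx tau (comb X) = c *: comb X.
    by apply: (can_inj (mulmxK N_unit)); rewrite E scalemxAl.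
  have [j xj0] : exists j, comb X 0 j != 0.
    apply/existsP; apply: contraNT X0; rewrite negb_exists => /forallP x0.
    rewrite -comb_eq0; apply/eqP/rowP => j; rewrite [RHS]mxE.
    by apply/eqP; rewrite -[_ == _]negbK x0.
  have /fin_all_exists[k kE] i : exists k : F, comb X 0 i / comb X 0 j = k *: 1.
    apply: (tau_fixed dimL tau1 tauM tau_neq).
    have Ei l : tau (comb X 0 l) = c * comb X 0 l.
      by have /rowP/(_ l) := E; rewrite !mxE.
    have c0 : c != 0.
      by apply: contraNneq xj0 => c0; rewrite -(tau_eq0 tau3) Ei c0 mul0r.
    rewrite tauM (tauV tau1 tauM tau3) !Ei invfM mulrACA divff // mul1r.
    by [].
  apply/rank_le1P; exists (comb X 0 j), (\row_i k i); apply/rowP => i.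
  have mE : map_mx (in_alg L) (\row_i k i) 0 i = comb X 0 i / comb X 0 j.
    by rewrite kE !mxE.
  by rewrite [RHS]mxE mE mulrC divfK.
apply/eqP/eq_vlineP => //; have l0 : l != 0.
  by apply: contraNneq X0 => l0; rewrite -comb_eq0 XE l0 scale0r.
exists (tau l / l); first by rewrite mulf_neq0 ?invr_eq0 // (tau_eq0 tau3).
rewrite scalemxAl; congr (_ *m _); rewrite XE; apply/rowP => i; rewrite !mxE.
rewrite tauM mulrA divfK //= linearZ /= tau1; by [].
Qed.

(** Singular exactly when the three conjugates of x are dependent over L; by [conj_mx_comb] and
    [conj_mx_unit], for x = [comb X] this is the singularity of X. *)
Definition conj_mx (x : 'rV[L]_3) := mk x (map_mx tau x) (map_mx tau (map_mx tau x)).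

Lemma conj_mx_comb X : conj_mx (comb X) = conj_mx nbasis *m map_mx (in_alg L) X.
Proof.
by apply/row_matrixP; apply: forall_ord3; rewrite row_mul !rowK /= -?tau_mulmx.
Qed.

(** A vector k killing this matrix kills every [conj_mx y]; constant rows y turn it into a linear
    relation between 1, tau and tau^2. *)
Lemma conj_mx_unit : conj_mx nbasis \in unitmx.
Proof.
rewrite unitmxE unitfE; apply/det0P => -[k k0 kB].
have [|k00 k01 k02] := @dedekind3 _ _ _ tau1 tauM tau3 tau_neq (k 0 0) (k 0 1) (k 0 2%:R).
  move=> x; pose y : 'rV[L]_3 := const_mx x.
  have : k *m conj_mx y = 0.
    by rewrite -(decombK y) conj_mx_comb mulmxA kB mul0mx.
  by rewrite /conj_mx mulmx_mk => /rowP/(_ 0); rewrite !mxE.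
case/eqP: k0; apply/rowP; apply: forall_ord3; by rewrite mxE.
Qed.

(** Distinctness of the conjugate points amounts to rank at least 2 by [phi_fixed_rank], and given
    that, their collinearity amounts to \det X = 0. *)
Lemma typeII_rank X : X != 0 ->
  typeII phi <[comb X *m N]>%VS <-> \rank X = 2%N.
Proof.
move=> X0; set P := <[comb X *m N]>%VS.
pose x1 := map_mx tau (comb X); pose x2 := map_mx tau x1.
have s0 Y : Y != 0 -> shift F *m Y != 0.
  by apply: contra_neq => sY; rewrite -(shift3 Y) sY !mulmx0.
have P1 : phi P = <[x1 *m N]>%VS by rewrite phi_comb // -tau_comb.
have P2 : phi (phi P) = <[x2 *m N]>%VS.
  by rewrite P1 /x2 /x1 !tau_comb phi_comb ?s0.
have dist : distinct3 P (phi P) (phi (phi P)) <-> (2 <= \rank X)%N.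
  rewrite ltnNge; split=> [[d _ _]|/negP r1].
    by apply/negP => /(phi_fixed_rank X0) E; apply: d; rewrite E.
  have d : P <> phi P by move=> E; apply: r1; apply/(phi_fixed_rank X0).
  split=> // E; apply: d; last exact: phi_inj.
  by rewrite {2}E phi3.
have kE (k : 'rV[L]_3) : k *m (conj_mx (comb X) *m N) = k 0 0 *: (comb X *m N) +
    k 0 1 *: (x1 *m N) + k 0 2%:R *: (x2 *m N).
  by rewrite mulmxA /conj_mx mulmx_mk !mulmxDl -!scalemxAl.
rewrite /typeII dist P2 P1.
have -> : \rank X = 2%N <-> (2 <= \rank X)%N /\ (\rank X < 3)%N.
  by split=> [->|[]] //; case: (\rank X) => [|[|[|]]].
split=> [[r2 [l dl []]]|[r2 r3]].
  rewrite -!memvE => v0l v1l v2l; split=> //; rewrite ltn_neqAle rank_leq_row andbT.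
  apply/negP => r3.
  have uX : map_mx (in_alg L) X \in unitmx.
    by rewrite map_unitmx -row_full_unit.
  have fr : free [:: comb X *m N; x1 *m N; x2 *m N].
    apply/free3P => k0 k1 k2 E; pose k : 'rV[L]_3 := \row_i [:: k0; k1; k2]`_i.
    have : k *m (conj_mx (comb X) *m N) = 0 by rewrite kE !mxE.
    rewrite conj_mx_comb.
    move=> /(congr1 (mulmxr (invmx (conj_mx nbasis *m map_mx (in_alg L) X *m N)))) /=.
    rewrite mulmxK ?mul0mx; last by rewrite !unitmx_mul conj_mx_unit uX.
    by move=> /rowP kk; have := (kk 0, kk 1, kk 2%:R); rewrite !mxE /= => -[[]].
  have : (<<[:: comb X *m N; x1 *m N; x2 *m N]>> <= l)%VS.
    by apply/span_subvP => u; rewrite !inE => /or3P[]/eqP->.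
  by move/dimvS; rewrite (eqP fr) dl.
split=> //.
have fr : free [:: comb X *m N; x1 *m N].
  apply/free2P => k0 k1 E; have v0 := comb_N_neq0 X0.
  have [k10|k10] := eqVneq k1 0.
    move: E; rewrite k10 scale0r addr0 => /eqP.
    by rewrite scaler_eq0 (negPf v0) orbF => /eqP ->.
  have [d _ _] := iffRL dist r2; case: d; rewrite P1; apply/esym/eqP/eq_vlineP => //.
  have x1E : x1 *m N = (- (k1^-1 * k0)) *: (comb X *m N).
    apply: (scalerI k10); rewrite scalerA mulrN mulVKf // scaleNr.
    by apply/eqP; rewrite -addr_eq0 addrC E.
  exists (- (k1^-1 * k0)) => //; apply/eqP => kk.
  have : shift F *m X != 0 by apply: s0.
  by move/comb_N_neq0; rewrite -tau_comb -/x1 x1E kk scale0r eqxx.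
exists <<[:: comb X *m N; x1 *m N]>>%VS; first by rewrite (eqP fr).
rewrite -!memvE; split.
- by apply: memv_span; rewrite inE eqxx.
- by apply: memv_span; rewrite !inE eqxx orbT.
have /det0P[k k0 kX] : \det (conj_mx (comb X)) == 0.
  rewrite conj_mx_comb det_mulmx det_map_mx mulf_eq0; apply/orP; right.
  rewrite fmorph_eq0; apply: contraTT r3 => dX.
  by rewrite -leqNgt mxrank_unit // unitmxE unitfE.
have : k *m (conj_mx (comb X) *m N) = 0 by rewrite mulmxA kX mul0mx.
rewrite kE => E.
(* The first two conjugates are independent, so the relation k must involve the third, which
   therefore lies on their line. *)
have k2 : k 0 2%:R != 0.
  apply: contraNneq k0 => k2; move: E; rewrite k2 scale0r addr0.
  case/(elimT (free2P _ _) fr) => k00 k01.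
  by apply/eqP/rowP; apply: forall_ord3; rewrite mxE.
rewrite -(scalerK k2 (x2 *m N)) memvZ //.
move/eqP: E; rewrite addrC addr_eq0 => /eqP->; rewrite memvN.
by apply/mem_span2; exists (k 0 0), (k 0 1).
Qed.

Lemma model_type_II A :
  type_point (typeII phi) A <-> exists2 X, \rank X = 2%N & A = <[model X]>%VS.
Proof.
split.
  move=> [/dim1_vline[w w0 ->] [P [/dim1_vline[v v0 ->] II]]].
  move: w0; rewrite -(model_invK w); move: (model_inv w) => X X0.
  rewrite -memvE mem_bose => /vlineP[l E]; exists X => //.
  have Xn0 : X != 0.
    by apply: contraNneq X0 => ->; rewrite /model comb0 mul0mx bose_vec0.
  apply/(typeII_rank Xn0); suff -> : <[comb X *m N]>%VS = <[v]>%VS by [].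
  apply/eqP/eq_vlineP => //; exists l => //.
  by apply: contraNneq (comb_N_neq0 Xn0) => l0; rewrite E l0 scale0r.
move=> [X r2 ->]; have X0 : X != 0 by rewrite -mxrank_eq0 r2.
split; first by rewrite dim_vline1 ?model_neq0.
exists <[comb X *m N]>%VS; split; first by rewrite dim_vline1 ?comb_N_neq0.
  exact/typeII_rank.
by rewrite -memvE mem_bose memv_line.
Qed.

End Coordinates.

Theorem theorem19 (F : finFieldType) (L : fieldExtType F) (q : nat) (n : int)
    (g : nat)
    (S : {vspace 'rV[L]_3} -> Prop)
    (phi : {vspace 'rV[L]_3} -> {vspace 'rV[L]_3})
    (sigma : {vspace bose_space L} -> {vspace bose_space L})
    (cardF : #|F| = q) (q_gt2 : (2 < q)%N) (dimL : \dim {:L} = 3%N)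
    (n_val : n = -1 \/ n = 0 \/ n = 1) (q_mod3 : (q%:Z = n %[mod 3])%Z)
    (g_val : g = gcdn 3 (q - 1))
    (S_subplane : Fq_subplane S)
    (phi_col : collineation phi) (phi_order3 : order3 phi)
    (phi_fix : forall P, S P -> phi P = P)
    (sigma_induced : induced_projectivity phi sigma) :
  [/\ forall pi, fixed_II_plane phi sigma pi ->
        (fixed_II1_plane S phi sigma q n g pi /\
           ~ fixed_II2_plane phi sigma q n g pi) \/
        (~ fixed_II1_plane S phi sigma q n g pi /\
           fixed_II2_plane phi sigma q n g pi),
      total_number (fixed_II1_plane S phi sigma q n g)
        (g%:Z * (q%:Z - 2 + g%:Z - n) * (q%:Z + 1) * (q%:Z ^+ 2 + q%:Z + 1))
    & total_number (fixed_II2_plane phi sigma q n g)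
        ((q%:Z ^+ 3 - q%:Z) * (q%:Z ^+ 2 + q%:Z + 1))].
Proof.
have [[f f_cube sigmaE] sigma_bose] := sigma_induced.
have f3 w : f (f (f w)) = w.
  by have := congr1 (fun h : 'End(bose_space L) => h w) f_cube; rewrite !comp_lfunE id_lfunE.
have f_bose P : \dim P = 1%N -> (f @: bose P)%VS = bose (phi P).
  by move=> dP; rewrite -sigmaE sigma_bose.
have [M M_unit SM] := S_subplane.
have [tau [N [[tau1 tauM tau3 tau_neq] N_unit fvecN SN]]] :=
  semilinear_form phi_col phi_order3 phi_fix f3 f_bose M_unit SM.
have [card_roots card_quad gn] := cube_root_counts cardF n_val q_mod3 g_val.
(* As g divides 3, it is 1 or 3; for g = 3 the inequality needs q >= 4, which holds because 3
   divides q - 1. *)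
have small : (#|[set w : F | (w ^+ 3 == 1)%R]| * (#|F| + #|F| ^ 2) < #|F| ^ 3)%N.
  rewrite card_roots cardF.
  have : (g %| 3)%N by rewrite g_val dvdn_gcdl.
  have gq : (g %| q - 1)%N by rewrite g_val dvdn_gcdr.
  rewrite dvdn_divisors // !inE => /orP[]/eqP /= gE; rewrite gE in gq *; first nia.
  by case/dvdnP: gq => k; rewrite /=; nia.
have [b cb] := normal_basis dimL tau1 tauM tau3 tau_neq small.
pose H : {linear 'M[F]_3 -> bose_space L} :=
  HB.pack (@model F L tau N b)
    (GRing.isLinear.Build F 'M[F]_3 (bose_space L) _ _ (@model_is_linear F L tau N b)).
have phi3 U : phi (phi (phi U)) = U by case: phi_order3.
have phiE := phi_vline phi_col f3 f_bose.
have HK : cancel H (model_inv tau N b) := modelK N_unit cb.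
have GK : cancel (model_inv tau N b) H := model_invK dimL N_unit cb.
have fH X : f (H X) = H (shift F *m X) by apply: f_model.
have tI := model_type_I dimL N_unit SN cb.
have tII := model_type_II dimL (collineation_inj phi_col) phi3 phiE tau1 tauM
  tau3 tau_neq N_unit fvecN cb.
have nq : (n < q%:Z)%R by case: n_val => [->|[->|->]]; lia.
split.
- exact: (fixed_II_plane_cases sigmaE HK GK fH tI tII cardF nq card_roots card_quad).
- exact: (total_II1 sigmaE HK GK fH tI tII cardF nq card_roots card_quad gn).
- exact: (total_II2 sigmaE HK GK fH tI tII cardF nq card_roots card_quad).
Qed.
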